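(* Let $d\ge1$ and $n>0$ be integers. For $f\in C(\triangle_H)$ define $$\mathcal{L}_n^*f(\mathbf t):=\sum_{\mathbf j\in\Lambda_n}f\big(\tfrac{\mathbf j}{(d+1)n}\big)\,\ell_{\mathbf j,n}^\triangle(\mathbf t),\qquad \ell_{\mathbf j,n}^\triangle(\mathbf t):=\frac{\lambda_{\mathbf j}^{(n)}}{(d+1)n^d}\sum_{\mathbf k\in\Lambda_n}\lambda_{\mathbf k}^{(n)}\,\mathsf{TC}_{\mathbf k}(\mathbf t)\,\overline{\mathsf{TC}_{\mathbf k}\big(\tfrac{\mathbf j}{(d+1)n}\big)}.$$ Then $\mathcal{L}_n^*f$ is the unique function in $\mathcal{TC}_n:=\mathrm{span}\{\mathsf{TC}_{\mathbf k}:\mathbf k\in\Lambda_n\}$ that satisfies $$\mathcal{L}_n^*f\big(\tfrac{\mathbf j}{(d+1)n}\big)=f\big(\tfrac{\mathbf j}{(d+1)n}\big),\qquad\mathbf j\in\Lambda_n.$$ Furthermore, the fundamental interpolation function is given by $$\ell_{\mathbf j,n}^\triangle(\mathbf t)=\lambda_{\mathbf j}^{(n)}\,\mathcal{P}^+\ell_{\mathbf j,n}(\mathbf t),\qquad \ell_{\mathbf j,n}(\mathbf t)=\Phi_n^*\big(\mathbf t-\tfrac{\mathbf j}{(d+1)n}\big),$$ where $\Phi_n^*(\mathbf t)=\frac1{(d+1)n^d}\sum_{\mathbf k\in\mathbb{H}_n^*}c_{\mathbf k}^{(n)}\phi_{\mathbf k}(\mathbf t)$ has the compact formula $$\Phi_n^*(\mathbf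 t)=\frac1{(d+1)n^d}\sum_{j=1}^{d+1}\Bigg(\prod_{\substack{i=1\\ i\ne j}}^{d+1}\frac{\sin\pi nt_i}{\sin\pi t_i}\Bigg)\cos(\pi nt_j)\sum_{I\subseteq\{1,\dots,d+1\}\setminus\{j\}}\frac{|I|!\,(d-|I|)!}{(d+1)!}\cos\pi\Big(t_j+2\sum_{i\in I}t_i\Big).$$
   Context: Let $\mathbb{R}_H^{d+1}=\{\mathbf t\in\mathbb{R}^{d+1}:t_1+\cdots+t_{d+1}=0\}$ and $\triangle_H=\{\mathbf t\in\mathbb{R}_H^{d+1}:0\le t_i-t_j\le1,\ 1\le i<j\le d+1\}$. Let $\mathbb{H}=\{\mathbf k\in\mathbb{Z}^{d+1}:k_1+\cdots+k_{d+1}=0,\ k_1\equiv\cdots\equiv k_{d+1}\ (\mathrm{mod}\ d+1)\}$ and $\phi_{\mathbf k}(\mathbf t)=e^{\frac{2\pi i}{d+1}\mathbf k\cdot\mathbf t}$. The group $\mathcal{G}=S_{d+1}$ acts by permuting coordinates, $\mathbf t\mapsto\mathbf t\sigma$. Define $\mathcal{P}^+f(\mathbf t)=\frac1{(d+1)!}\sum_{\sigma\in\mathcal{G}}f(\mathbf t\sigma)$ and the generalized cosine functions $\mathsf{TC}_{\mathbf k}=\mathcal{P}^+\phi_{\mathbf k}$, $\mathbf k\in\mathbb{H}$. Let $\Lambda_n=\{\mathbf k\in\mathbb{H}:k_{d+1}\le k_d\le\cdots\le k_1\le k_{d+1}+(d+1)n\}$. For $\mathbf j\in\Lambda_n$ write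 $\mathbf j=(\{j_1\}^{p_1},\dots,\{j_\ell\}^{p_\ell})$ with distinct values $j_1>\cdots>j_\ell$ repeated $p_1,\dots,p_\ell\ge1$ times, $p_1+\cdots+p_\ell=d+1$, and set $$\lambda_{\mathbf j}^{(n)}=\begin{cases}\dfrac{(d+1)!}{p_1!\,p_2!\cdots p_\ell!}&\text{if } j_1<j_\ell+(d+1)n,\\[8pt] \dfrac{(d+1)!}{(p_1+p_\ell)!\,p_2!\cdots p_{\ell-1}!}&\text{if } j_1=j_\ell+(d+1)n.\end{cases}$$ Further, $\mathbb{H}_n^*=\{\mathbf k\in\mathbb{H}:-n\le\tfrac{k_i-k_j}{d+1}\le n,\ 1\le i<j\le d+1\}$, and for $\mathbf k\in\mathbb{H}_n^*$: $c_{\mathbf k}^{(n)}=1$ if $\max_ik_i-\min_ik_i<(d+1)n$, while $c_{\mathbf k}^{(n)}=1/\binom{a+b}{a}$ if $\max_ik_i-\min_ik_i=(d+1)n$, where $a$ (resp. $b$) is the number of indices at which $\mathbf k$ attains its maximum (resp. minimum) coordinate. Quotients $\sin\pi nt/\sin\pi t$ are interpreted by continuous extension. *)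

(* Defs.v *)
From HB Require Import structures.
From mathcomp Require Import all_boot all_order all_fingroup all_algebra.
From mathcomp Require Import all_classical all_reals all_analysis.
From mathcomp Require Import complex.
From mathcomp Require Import zify.

Set Implicit Arguments.
Unset Strict Implicit.
Unset Printing Implicit Defensive.

Import Order.TTheory GRing.Theory Num.Theory.
Import numFieldNormedType.Exports.

Local Open Scope classical_set_scope.
Local Open Scope ring_scope.
Local Open Scope complex_scope.

(* Vectors of R^(d+1) and Z^(d+1) are rows indexed by 'I_d.+1, so t_1, ...,
   t_(d+1) are t 0 ord0, ..., t 0 ord_max.  Functions on the hyperplane RH or
   on the simplex triangleH are represented by functions on the whole of
   'rV[R]_d.+1; they are only constrained, and only compared, on these sets. *)

Section Domains.
Variables (R : realType) (d : nat).

Definition RH : set 'rV[R]_d.+1 := [set t : 'rV[R]_d.+1 | \sum_i t 0 i = 0].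

Definition triangleH : set 'rV[R]_d.+1 :=
  [set t : 'rV[R]_d.+1 | RH t /\
     forall i j : 'I_d.+1, (i < j)%N -> 0 <= t 0 i - t 0 j <= 1].

End Domains.
Arguments RH : clear implicits.
Arguments triangleH : clear implicits.

Section Indices.
Variables (d n : nat).
Implicit Type k : 'rV[int]_d.+1.

Definition HH : set 'rV[int]_d.+1 :=
  [set k : 'rV[int]_d.+1 | \sum_i k 0 i = 0 /\
     forall i j : 'I_d.+1, (k ord0 i = k ord0 j %[mod d.+1%:Z])%Z].

Definition Lambda : set 'rV[int]_d.+1 :=
  [set k : 'rV[int]_d.+1 | [/\ HH k,
     (forall i j : 'I_d.+1, (i <= j)%N -> k 0 j <= k 0 i) &
     k 0 ord0 <= k 0 ord_max + (d.+1 * n)%N%:Z]].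

Definition Hstar : set 'rV[int]_d.+1 :=
  [set k : 'rV[int]_d.+1 | HH k /\
     forall i j : 'I_d.+1, (i < j)%N ->
       - n%:R <= ((k 0 i - k 0 j)%:~R / d.+1%:R : rat) <= n%:R].

(* Sums over Lambda and Hstar below are finitely supported sums \sum_(k \in _),
   which are the intended sums because these sets are finite. *)
Lemma finite_bounded_rV (m M : nat) :
  finite_set [set k : 'rV[int]_m | forall i, `|k 0 i| <= M%:Z].
Proof.
pose F (h : {ffun 'I_m -> 'I_(M.*2.+1)}) : 'rV[int]_m :=
  \row_i ((h i : nat)%:Z - M%:Z).
apply: (@sub_finite_set _ _ (range F)); last first.
  exact/finite_image/finite_finset.
move=> k /= hk; exists [ffun i => inord (absz (k 0 i + M%:Z))] => //.
apply/rowP => i; rewrite mxE ffunE inordK; have := hk i; lia.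
Qed.

Lemma finite_HH_bounded (B : nat) :
  finite_set [set k | HH k /\ forall i j : 'I_d.+1, k 0 i - k 0 j <= B%:Z].
Proof.
apply: sub_finite_set (finite_bounded_rV d.+1 (d.+1 * B)) => k /= [[s0 _] hk] i.
have sumE : \sum_(j < d.+1) (k 0 i - k 0 j) = k 0 i * d.+1%:Z.
  by rewrite sumrB s0 subr0 sumr_const card_ord pmulrn -mulrzr intz.
have sB : \sum_(j < d.+1) B%:Z = (d.+1 * B)%N%:Z.
  by rewrite sumr_const card_ord pmulrn -mulrzr intz; lia.
have u : \sum_(j < d.+1) (k 0 i - k 0 j) <= \sum_(j < d.+1) B%:Z.
  by apply: ler_sum => j _.
have l : \sum_(j < d.+1) - B%:Z <= \sum_(j < d.+1) (k 0 i - k 0 j).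
  by apply: ler_sum => j _; have := hk j i; lia.
by move: u l; rewrite sumrN sB sumE; nia.
Qed.

Lemma finite_Lambda : finite_set Lambda.
Proof.
apply: sub_finite_set (finite_HH_bounded (d.+1 * n)) => k [hk s b]; split=> // i j.
have := s ord0 i (leq0n _); have := s j ord_max (leq_ord j); lia.
Qed.

Lemma finite_Hstar : finite_set Hstar.
Proof.
apply: sub_finite_set (finite_HH_bounded (d.+1 * n)) => k [hk s]; split=> // i j.
have h (i' j' : 'I_d.+1) : (i' < j')%N ->
    - (d.+1 * n)%N%:Z <= k 0 i' - k 0 j' <= (d.+1 * n)%N%:Z.
  move=> /s /andP[]; rewrite ler_pdivlMr ?ltr0n// ler_pdivrMr ?ltr0n//.
  rewrite mulNr -natrM mulnC -[(_ * _)%N%:R]/((_ * _)%N%:Z%:~R) -rmorphN /=.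
  by rewrite !ler_int => -> ->.
by case: (ltngtP i j) => [/h|/h|/val_inj ->]; lia.
Qed.

Definition mult k (v : int) : nat := #|[set i | k 0 i == v]%SET|.

Definition values k : seq int := undup [seq k 0 i | i : 'I_d.+1].

Definition kmax k : int := \big[Order.max/k 0 ord0]_i k 0 i.
Definition kmin k : int := \big[Order.min/k 0 ord0]_i k 0 i.

End Indices.
Arguments HH : clear implicits.
Arguments Lambda : clear implicits.
Arguments Hstar : clear implicits.

Section Weights.
Variables (R : realType) (d n : nat).
Implicit Type k : 'rV[int]_d.+1.

(* Used for k in Lambda d n only: the largest coordinate of k is then k 0 ord0,
   the smallest one is k 0 ord_max, and the second case is that of
   k 0 ord0 = k 0 ord_max + (d + 1) n. *)
Definition lambda k : R[i] :=
  let kfirst := k 0 ord0 in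
  let klast := k 0 ord_max in
  if kfirst < klast + (d.+1 * n)%N%:Z then
    d.+1`!%:R / (\prod_(v <- values k) (mult k v)`!)%N%:R
  else
    d.+1`!%:R /
      ((mult k kfirst + mult k klast)`! *
       \prod_(v <- values k | (v != kfirst) && (v != klast)) (mult k v)`!)%N%:R.

Definition cweight k : R[i] :=
  if kmax k - kmin k < (d.+1 * n)%N%:Z then 1
  else 1 / 'C(mult k (kmax k) + mult k (kmin k), mult k (kmax k))%:R.

End Weights.
Arguments lambda R {d} n k.
Arguments cweight R {d} n k.

Section Functions.
Variables (R : realType) (d : nat).
Implicit Types (t : 'rV[R]_d.+1) (k j : 'rV[int]_d.+1).
Implicit Types f g : 'rV[R]_d.+1 -> R[i].

Definition expi (x : R) : R[i] := cos x +i* sin x.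

Definition phi k t : R[i] :=
  expi (2 * pi / d.+1%:R * \sum_i (k 0 i)%:~R * t 0 i).

Definition Pplus f t : R[i] :=
  d.+1`!%:R^-1 * \sum_(s : 'S_d.+1) f (col_perm s t).

Definition TC k : 'rV[R]_d.+1 -> R[i] := Pplus (phi k).

Definition node (n : nat) j : 'rV[R]_d.+1 :=
  \row_i ((j 0 i)%:~R / (d.+1 * n)%N%:R).

Definition ell_triangle (n : nat) j t : R[i] :=
  lambda R n j / (d.+1 * n ^ d)%N%:R *
  \sum_(k \in Lambda d n) lambda R n k * TC k t * (TC k (node n j))^*.

Definition Lstar (n : nat) f t : R[i] :=
  \sum_(j \in Lambda d n) f (node n j) * ell_triangle n j t.

Definition inTC (n : nat) g : Prop :=
  exists a : 'rV[int]_d.+1 -> R[i],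
    forall t, RH R d t -> g t = \sum_(k \in Lambda d n) a k * TC k t.

Definition interpolates (n : nat) g f : Prop :=
  forall j, Lambda d n j -> g (node n j) = f (node n j).

Definition Phistar (n : nat) t : R[i] :=
  (d.+1 * n ^ d)%N%:R^-1 * \sum_(k \in Hstar d n) cweight R n k * phi k t.

Definition ell (n : nat) j t : R[i] := Phistar n (t - node n j).

(* sin (pi n x) / sin (pi x), continuously extended to the integers. *)
Definition sin_quotient (n : nat) (x : R) : R :=
  if sin (pi * x) == 0
  then lim (sin (pi * n%:R * y) / sin (pi * y) @[y --> x^'])
  else sin (pi * n%:R * x) / sin (pi * x).

Definition Phistar_compact (n : nat) t : R :=
  (d.+1 * n ^ d)%N%:R^-1 *
  \sum_(j < d.+1)
    (\prod_(i < d.+1 | i != j) sin_quotient n (t 0 i)) *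
    cos (pi * n%:R * t 0 j) *
    (\sum_(I : {set 'I_d.+1} | j \notin I)
       ((#|I|)`! * (d - #|I|)`!)%N%:R / d.+1`!%:R *
       cos (pi * (t 0 j + 2 * \sum_(i in I) t 0 i))).

End Functions.

(* Main.v *)
Require Import Defs.
From HB Require Import structures.
From mathcomp Require Import all_boot all_order all_fingroup all_algebra.
From mathcomp Require Import all_classical all_reals all_analysis.
From mathcomp Require Import complex finmap.
From mathcomp Require Import ring lra zify.

(** Put [x_i = exp (2 pi i t_i)]; on the hyperplane the product of the [x_i] is
    1.  The index set of [Phi*_n] is parametrised by the vectors [a] of
    [{0, ..., n}^(d+1)] with some entry 0, through
    [k_i = (d+1) a_i - (a_1 + ... + a_(d+1))], and then [phi_k (t)] is the
    monomial [x^a] (lattice_point, phi_lattice_point).  If [p] entries of [a] are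
    [n] and [q] entries are 0, the weight [c_k], the inverse of a binomial
    coefficient, is [q] times the beta integral [int_0^1 u^p (1 - u)^(q-1) du].
    The factor [q] counts the indices [j] with [a_j = 0], and for each of them the
    integrand is the product over [i <> j] of weights that depend on [a_i] only:
    [1 - u] for [a_i = 0], [u] for [a_i = n] and 1 otherwise.  Summing over [a] the
    products factor, and the weighted sum of the [phi_k (t)] becomes

      [K (x) = sum_j  prod_(i <> j) (1 + x_i + ... + x_i^(n-1))
                    * int_0^1 prod_(i <> j) (1 - u + u x_i) du]

    (interp_kernel_expansion, sum_Hstar_phi).  The remaining integral expands,
    again by beta integrals, with the coefficients [|I|! (d-|I|)! / (d+1)!] of
    the compact formula (integral01_prod_mixture).

    Everything analytic about [K] comes from one identity: the derivative in [u]
    of [prod_i (1 - u + u x_i)] is [sum_j (x_j - 1) prod_(i <> j) (1 - u + u x_i)],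
    so that [sum_j (x_j - 1) int_0^1 prod_(i <> j) (1 - u + u x_i) du] equals
    [prod_i x_i - 1], which vanishes on the hyperplane (sum_integral01_mixture).
    It has two uses.

    - Since [1 - x^n = (1 - x) (1 + ... + x^(n-1))], each summand of [K] may be
      multiplied by [(1 + x_j^n) / 2] without changing the sum
      (interp_kernel_symmetrized).  In this form the real trigonometric
      expression is read off term by term (Phistar_compactE).
    - At a node all the [x_i^n] have a common value [w], so that a geometric sum is
      [(w - 1) / (x_i - 1)] unless [x_i = 1]; hence [K] vanishes there, except when
      all [x_i] are 1 (interp_kernel0).  This is the discrete orthogonality of the
      exponentials [phi_k] on the weighted nodes (phi_discrete_orthogonality).

    The symmetric group acts on all this.  Each orbit in the index set of
    [Phi*_n] meets [Lambda_n] exactly once, and [lambda_k] is [c_k] times the size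
    of the orbit, so sums with the weights [c_k] fold into sums over [Lambda_n]
    with the weights [lambda_k] (sum_Hstar).  Folding the orthogonality of the
    exponentials makes the [TC_k] orthogonal on the nodes of [Lambda_n]
    (TC_gram): different [k], [l] of [Lambda_n] stay different modulo [(d+1) n]
    and permutations, and [(d+1)! / lambda_k] permutations fix [k] modulo
    [(d+1) n] (alcove_unique, lambda_stabmod).  As the node of [j] and the index
    [k] enter [TC_k] symmetrically, this one relation gives both that
    [ell_j] is 1 at its own node and 0 at the others, and that interpolation
    reproduces every [TC_k], hence uniqueness.  Folding [Phi*_n] itself gives the
    formula for [ell_j]. *)

Set Implicit Arguments.
Unset Strict Implicit.
Unset Printing Implicit Defensive.

Import Order.TTheory GRing.Theory Num.Theory.
Import numFieldNormedType.Exports.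

Local Open Scope ring_scope.

(** * Integrating polynomials over the unit interval *)

Section IntegralOfPolynomials.
Variable F : numFieldType.
Implicit Types p q : {poly F}.

(** The integral of [p] over the unit interval, read off the coefficients.  Both the
    inverse binomial weights and the weights [|I|! (d-|I|)! / (d+1)!] are beta
    integrals, and this functional lets them be handled together. *)
Definition integral01 p : F := \sum_(i < size p) p`_i / i.+1%:R.

Lemma integral01E m p : (size p <= m)%N ->
  integral01 p = \sum_(i < m) p`_i / i.+1%:R.
Proof.
move=> pm; rewrite /integral01.
rewrite (big_ord_widen m (fun i => p`_i / i.+1%:R) pm) big_mkcond /=.
apply: eq_bigr => i _; case: ltnP => // h.
by rewrite nth_default ?mul0r.
Qed.

Lemma integral01_is_linear : linear_for *%R integral01.
Proof.
move=> a p q.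
have m1 : (size p <= maxn (size p) (size q))%N by rewrite leq_maxl.
have m2 : (size q <= maxn (size p) (size q))%N by rewrite leq_maxr.
have m3 : (size (a *: p + q)%R <= maxn (size p) (size q))%N.
  by rewrite (leq_trans (size_polyD _ _))// geq_max m2 (leq_trans (size_scale_leq _ _)).
rewrite (integral01E m1) (integral01E m2) (integral01E m3) mulr_sumr -big_split.
by apply: eq_bigr => i _; rewrite coefD coefZ mulrDl mulrA.
Qed.

HB.instance Definition _ :=
  GRing.isLinear.Build F {poly F} F *%R integral01 integral01_is_linear.

Lemma integral01_deriv p : integral01 p^`() = p.[1] - p.[0].
Proof.
have sp : (size p^`() <= size p)%N.
  by have [->|/lt_size_deriv/ltnW//] := eqVneq p 0; rewrite deriv0.
rewrite (integral01E sp) horner_coef0 horner_coef.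
case E : (size p) => [|m].
  by rewrite !big_ord0 nth_default ?E ?subrr.
rewrite big_ord_recr /= coef_deriv.
rewrite [p`_m.+1]nth_default ?E // mul0rn mul0r addr0.
rewrite [X in _ = X - _]big_ord_recl /= expr0 mulr1 addrC addKr.
apply: eq_bigr => i _.
by rewrite coef_deriv expr1n mulr1 -[X in X / _]mulr_natr mulfK// pnatr_eq0.
Qed.

Lemma integral01_beta a b :
  integral01 ('X^a * (1 - 'X) ^+ b) = a`!%:R * b`!%:R / (a + b).+1`!%:R.
Proof.
elim: b a => [|b IHb] a.
  rewrite expr0 mulr1 addn0 fact0 mulr1 /integral01 size_polyXn big_ord_recr /=.
  rewrite big1 => [|i _]; last by rewrite coefXn ltn_eqF// mul0r.
  rewrite coefXn eqxx add0r factS natrM invfM.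
  by rewrite mulrCA mulfV ?mulr1 ?mul1r// pnatr_eq0 -lt0n fact_gt0.
have -> : 'X^a * (1 - 'X) ^+ b.+1 =
    'X^a * (1 - 'X) ^+ b - 'X^(a.+1) * (1 - 'X) ^+ b :> {poly F}.
  by rewrite !exprS; ring.
rewrite linearB /= !IHb addnS addSn !factS.
have h0 : (a + b)`!%:R != 0 :> F by rewrite pnatr_eq0 -lt0n fact_gt0.
have h1 : (a + b).+1%:R != 0 :> F by rewrite pnatr_eq0.
have h2 : (a + b).+2%:R != 0 :> F by rewrite pnatr_eq0.
rewrite !natrM invfM.
have E1 : (a.+1%:R : F) = a%:R + 1 by rewrite -natr1.
have E2 : (b.+1%:R : F) = b%:R + 1 by rewrite -natr1.
have E3 : ((a + b).+1%:R : F) = a%:R + b%:R + 1 by rewrite -natr1 natrD.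
have E4 : ((a + b).+2%:R : F) = a%:R + b%:R + 2 by rewrite -natr1 E3; ring.
rewrite E4 E3 in h1 h2 *; rewrite E1 E2; field.
by rewrite h0 h2 h1.
Qed.
End IntegralOfPolynomials.

(** * The interpolation kernel *)

Section Kernel.
Variables (F : numFieldType) (I : finType) (n : nat).
Implicit Types (x : I -> F) (j : I).

Lemma deriv_prod (p : I -> {poly F}) :
  (\prod_i p i)^`() = \sum_j (p j)^`() * \prod_(i | i != j) p i.
Proof.
elim: (index_enum I) (index_enum_uniq I) => [|k r IHr] /=.
  by rewrite !big_nil -[1]/(1%:P) derivC.
case/andP=> kr ur; rewrite !big_cons derivM IHr// eqxx /=; congr (_ * _ + _).
  rewrite big_seq [RHS]big_seq_cond; apply: eq_bigl => i.
  by case ir: (i \in r) => //=; apply/esym; apply: contraNneq kr => <-.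
rewrite mulr_sumr big_seq [RHS]big_seq; apply: eq_bigr => j jr.
by rewrite big_cons ifT 1?mulrCA//; apply: contraNneq kr => ->.
Qed.

Definition mixture (y : F) : {poly F} := 1 - 'X + y *: 'X.

Lemma deriv_mixture y : (mixture y)^`() = (y - 1)%:P.
Proof.
rewrite /mixture derivD derivB derivZ derivX -[1]/(1%:P) derivC polyCB -mul_polyC.
by ring.
Qed.

Lemma horner_mixture y u : (mixture y).[u] = 1 - u + y * u.
Proof. by rewrite /mixture !hornerE. Qed.

(** The left-hand side is the integral of the derivative of
    [prod_i (1 - u + u x_i)], whose values at [u = 1] and [u = 0] are
    [prod_i x_i] and 1. *)
Lemma sum_integral01_mixture x :
  \sum_j (x j - 1) * integral01 (\prod_(i | i != j) mixture (x i)) =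
  \prod_i x i - 1.
Proof.
have := integral01_deriv (\prod_i mixture (x i)).
rewrite deriv_prod linear_sum /= !horner_prod.
under eq_bigr => j _ do rewrite deriv_mixture mul_polyC linearZ /=.
move=> ->; congr (_ - _).
  by apply: eq_bigr => i _; rewrite horner_mixture subrr add0r mulr1.
by apply: big1 => i _; rewrite horner_mixture mulr0 addr0 subr0.
Qed.

Definition geom (y : F) : F := \sum_(b < n) y ^+ b.

Lemma geomE y : (y - 1) * geom y = y ^+ n - 1.
Proof. by rewrite subrX1. Qed.

(** For [x_i = exp (2 pi i t_i)] with [t] in the hyperplane this is
    [(d+1) n^d Phi*_n (t)]. *)
Definition interp_kernel x : F :=
  \sum_j (\prod_(i | i != j) geom (x i)) *
         integral01 (\prod_(i | i != j) mixture (x i)).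

(** The two sides differ by half of a sum with factors [x_j^n - 1].  Such a factor is
    [x_j - 1] times the geometric sum missing in the [j]-th product, so that sum is
    the full product of the geometric sums times one that vanishes by
    [sum_integral01_mixture]. *)
Lemma interp_kernel_symmetrized x : \prod_i x i = 1 ->
  \sum_j (1 + x j ^+ n) / 2 * ((\prod_(i | i != j) geom (x i)) *
         integral01 (\prod_(i | i != j) mixture (x i))) = interp_kernel x.
Proof.
move=> x1; pose S := \sum_j (x j ^+ n - 1) * ((\prod_(i | i != j) geom (x i)) *
         integral01 (\prod_(i | i != j) mixture (x i))).
have S0 : S = 0.
  transitivity (\prod_i geom (x i) * (\prod_i x i - 1)); last by rewrite x1 subrr mulr0.
  rewrite -sum_integral01_mixture mulr_sumr; apply: eq_bigr => j _.
  by rewrite -geomE [in RHS](bigD1 j) //=; ring.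
apply/eqP; rewrite -subr_eq0; apply/eqP.
transitivity (S / 2); last by rewrite S0 mul0r.
rewrite /S /interp_kernel mulr_suml -sumrB; apply: eq_bigr => j _.
by set P := _ * integral01 _; field.
Qed.

Lemma interp_kernel1 : interp_kernel (fun=> 1) = (#|I| * n ^ #|I|.-1)%N%:R.
Proof.
rewrite /interp_kernel.
have g1 : geom 1 = n%:R.
  by rewrite /geom (eq_bigr (fun=> 1)) ?sumr_const ?card_ord// => i _; rewrite expr1n.
have m1 : mixture 1 = 1 by rewrite /mixture scale1r subrK.
have i1 : integral01 (1 : {poly F}) = 1.
  by rewrite /integral01 size_poly1 big_ord1 coef1 divr1.
rewrite (eq_bigr (fun=> n%:R ^+ #|I|.-1)) => [|j _].
  by rewrite sumr_const -[LHS]mulr_natl natrM natrX.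
by rewrite g1 m1 big1_eq i1 mulr1 prodr_const -(cardC1 j).
Qed.

(** If no [x_i] is 1 then every geometric sum is [(w - 1) / (x_i - 1)], and clearing
    denominators leaves the vanishing sum of [sum_integral01_mixture].  If some
    [x_i] is 1 then [w = 1] and the geometric sums of the entries other than 1
    vanish; there are at least two such entries because the product is 1, so that
    each summand contains one of these sums. *)
Lemma interp_kernel0 x (w : F) : \prod_i x i = 1 -> (forall i, x i ^+ n = w) ->
  ~ (forall i, x i = 1) -> interp_kernel x = 0.
Proof.
move=> x1 xw nx; have [/existsP[k /eqP xk]|/existsPn h] := boolP [exists k, x k == 1].
  have w1 : w = 1 by rewrite -(xw k) xk expr1n.
  have g0 i : x i != 1 -> geom (x i) = 0.
    move=> xi; have /eqP := geomE (x i).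
    by rewrite xw w1 subrr mulf_eq0 subr_eq0 (negPf xi) => /eqP.
  have [m xm] : exists m, x m != 1.
    apply/existsP; have [//|/existsPn h] := boolP [exists m, x m != 1].
    by case: nx => i; apply/eqP/negPn/h.
  have [m' m'm xm'] : exists2 m', m' != m & x m' != 1.
    apply/exists_inP; have [//|/exists_inPn h] := boolP [exists (m' | m' != m), x m' != 1].
    case/eqP: xm.
    rewrite -x1 (bigD1 m)//= big1 ?mulr1// => i im.
    by have /negPn/eqP := h i im.
  rewrite /interp_kernel big1// => j _.
  have [->|jm] := eqVneq j m.
    by rewrite (bigD1 m')//= g0// !mul0r.
  by rewrite (bigD1 m) 1?eq_sym//= g0// !mul0r.
have g i : geom (x i) = (w - 1) / (x i - 1).
  by rewrite -(xw i) -geomE mulrC mulKf// subr_eq0.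
have P0 : \prod_i (x i - 1) != 0.
  by apply/prodf_neq0 => i _; rewrite subr_eq0.
apply: (mulfI P0); rewrite mulr0 /interp_kernel mulr_sumr.
transitivity ((w - 1) ^+ #|I|.-1 * (\prod_i x i - 1)); last by rewrite x1 subrr mulr0.
rewrite -sum_integral01_mixture mulr_sumr; apply: eq_bigr => j _.
have E : \prod_(i | i != j) (x i - 1) * \prod_(i | i != j) geom (x i) =
    (w - 1) ^+ #|I|.-1.
  rewrite -big_split /= -(cardC1 j) -prodr_const.
  by apply: eq_bigr => i _; rewrite geomE xw.
by rewrite (bigD1 j)//= -E; ring.
Qed.

End Kernel.

Section Expansions.
Variables (F : numFieldType) (I : finType) (n : nat).
Implicit Types (x : I -> F) (j : I).

(** Choosing [u x_i] for [i] in [J] and [1 - u] elsewhere leaves the beta integral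
    of [u^|J| (1 - u)^(d-|J|)]. *)
Lemma integral01_prod_mixture x j :
  integral01 (\prod_(i | i != j) mixture (x i)) =
  \sum_(J : {set I} | j \notin J)
     ((#|J|)`! * (#|I|.-1 - #|J|)`!)%N%:R / (#|I|)`!%:R * \prod_(i in J) x i.
Proof.
(* The factor at [j] is split as 0 + 1, which makes the product run over all indices. *)
pose f i : {poly F} := if i == j then 0 else x i *: 'X.
pose g i : {poly F} := if i == j then 1 else 1 - 'X.
have -> : \prod_(i | i != j) mixture (x i) = \prod_i (f i + g i).
  rewrite [RHS](bigD1 j)//= /f /g eqxx add0r mul1r.
  by apply: eq_bigr => i /negPf ->; rewrite addrC.
rewrite bigA_distr linear_sum /= [RHS]big_mkcond; apply: eq_bigr => J _.
case: ifPn => [jJ|/negPn jJ]; last first.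
  by rewrite (bigD1 j)//= jJ /f eqxx mul0r linear0.
have -> : \prod_i (if i \in J then f i else g i) =
    (\prod_(i in J) x i) *: ('X^#|J| * (1 - 'X) ^+ (#|I|.-1 - #|J|)).
  rewrite (bigID (mem J)) /=.
  have -> : \prod_(i in J) (if i \in J then f i else g i) =
      (\prod_(i in J) x i) *: 'X^#|J|.
    rewrite -prodr_const -scaler_prod; apply: eq_bigr => i iJ.
    by rewrite iJ /f ifN//; apply: contraNneq jJ => <-.
  rewrite -scalerAl; congr (_ *: (_ * _)).
  rewrite (bigD1 j)//= (negPf jJ) /g eqxx mul1r.
  have -> : (#|I|.-1 - #|J| = #|[pred i | (i \notin J) && (i != j)]|)%N.
    have := cardC (mem (j |: J)%SET); rewrite cardsU1 jJ.
    have -> : #|[predC (j |: J)%SET]| = #|[pred i | (i \notin J) && (i != j)]|.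
      by apply: eq_card => i; rewrite !inE negb_or andbC.
    by set m := #|[pred i | _]|; move=> <-; lia.
  rewrite -prodr_const; apply: eq_bigr => i /andP[/negPf -> /negPf ij].
  by rewrite ij.
rewrite linearZ /= integral01_beta natrM mulrC; congr (_ * _); congr (_ / _`!%:R).
have := max_card (mem (j |: J)%SET); rewrite cardsU1 jJ /= add1n.
by set c := #|J|; set m := #|I|; lia.
Qed.

Definition nlow (a : {ffun I -> 'I_n.+1}) := #|[pred i | a i == 0%N :> nat]|.
Definition nhigh (a : {ffun I -> 'I_n.+1}) := #|[pred i | a i == n :> nat]|.

(** The weight of the exponent [b] in the product of a geometric sum and a mixture:
    [1 - u] at [b = 0], [u] at [b = n], and 1 in between. *)
Let edge (b : nat) : {poly F} := (b < n)%N%:R *: (1 - 'X) + (0 < b)%N%:R *: 'X.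

Lemma geom_mixture y :
  (geom n y) *: mixture y = \sum_(b < n.+1) y ^+ b *: edge b.
Proof.
rewrite /edge; under eq_bigr => b _ do rewrite scalerDr !scalerA.
rewrite big_split /= -!scaler_suml.
have -> : \sum_(i < n.+1) y ^+ i * (i < n)%N%:R = geom n y.
  rewrite big_ord_recr /= ltnn mulr0 addr0; apply: eq_bigr => i _.
  by rewrite ltn_ord mulr1.
have -> : \sum_(i < n.+1) y ^+ i * (0 < i)%N%:R = y * geom n y.
  rewrite big_ord_recl /= mulr0 add0r mulr_sumr; apply: eq_bigr => i _.
  by rewrite exprS mulr1.
by rewrite /mixture scalerDr scalerA [y * _]mulrC.
Qed.

Lemma beta_weight p q : q`!%:R * (p`!%:R / (p + q)`!%:R) = 'C(p + q, p)%:R^-1 :> F.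
Proof.
have := bin_fact (leq_addr q p); rewrite addKn => <-.
have h1 : p`!%:R != 0 :> F by rewrite pnatr_eq0 -lt0n fact_gt0.
have h2 : q`!%:R != 0 :> F by rewrite pnatr_eq0 -lt0n fact_gt0.
have h3 : 'C(p + q, p)%:R != 0 :> F by rewrite pnatr_eq0 -lt0n bin_gt0 leq_addr.
by rewrite !natrM; field; rewrite h1 h2 h3.
Qed.

(** In the [j]-th summand the entry [a_j] is 0 and the other entries contribute
    their weights, that is [u^p (1 - u)^(q-1)]; its integral does not depend on
    [j], and there are [q] choices of [j]. *)
Lemma interp_kernel_expansion x : (0 < n)%N ->
  interp_kernel n x = \sum_(a : {ffun I -> 'I_n.+1} | [exists i, a i == 0%N :> nat])
    'C(nhigh a + nlow a, nhigh a)%:R^-1 * \prod_i x i ^+ a i.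
Proof.
move=> n0; rewrite /interp_kernel.
(* The sum over [b] of [h j j b] is 1: it stands for the factor left out at [j]. *)
pose h j i (b : 'I_n.+1) : {poly F} :=
  if i == j then (b == 0%N :> nat)%:R else x i ^+ b *: edge b.
have E j : (\prod_(i | i != j) geom n (x i)) *
      integral01 (\prod_(i | i != j) mixture (x i)) =
    \sum_(a : {ffun I -> 'I_n.+1}) integral01 (\prod_i h j i (a i)).
  rewrite -[LHS](linearZ_LR (@integral01 F)) /= -linear_sum /= -bigA_distr_bigA /=.
  rewrite -scaler_prod; congr integral01; rewrite [RHS](bigD1 j)//=.
  have -> : \sum_b h j j b = 1.
    rewrite (bigD1 ord0)//= big1 => [|b b0]; last first.
      by rewrite /h eqxx; case: eqP => // /eqP bz; rewrite -val_eqE /= bz in b0.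
    by rewrite /h eqxx /= addr0.
  rewrite mul1r; apply: eq_bigr => i /negPf ij.
  by rewrite geom_mixture; apply: eq_bigr => b _; rewrite /h ij.
rewrite (eq_bigr _ (fun j _ => E j)) exchange_big [RHS]big_mkcond /=.
apply: eq_bigr => a _.
have T j : integral01 (\prod_i h j i (a i)) =
    if a j == 0%N :> nat then (\prod_i x i ^+ a i) *
      ((nlow a).-1`!%:R * ((nhigh a)`!%:R / (nhigh a + nlow a)`!%:R)) else 0.
  rewrite (bigD1 j)//= {1}/h eqxx; case: ifP => aj; last by rewrite mul0r linear0.
  have q0 : (0 < nlow a)%N by apply/card_gt0P; exists j.
  rewrite mul1r.
  have -> : \prod_(i | i != j) h j i (a i) =
      (\prod_i x i ^+ a i) *: ('X^(nhigh a) * (1 - 'X) ^+ (nlow a).-1).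
    rewrite [\prod_i _](bigD1 j)//= (eqP aj) expr0 mul1r.
    rewrite (eq_bigr (fun i => x i ^+ a i *: ((if a i == n :> nat then 'X else 1) *
      (if a i == 0%N :> nat then 1 - 'X else 1)))) => [|i /negPf ij]; last first.
      rewrite /h ij; congr (_ *: _); rewrite /edge.
      have [->|an] := eqVneq (val (a i)) n.
        by rewrite ltnn n0 scale0r scale1r add0r gtn_eqF // mulr1.
      have -> : (a i < n)%N by rewrite ltn_neqAle an -ltnS ltn_ord.
      case: (val (a i)) => [|b] /=; rewrite ?scale0r ?scale1r ?addr0 ?mul1r//.
      by rewrite subrK.
    rewrite scaler_prod big_split /= -!big_mkcondr /= !prodr_const.
    congr (_ *: (_ ^+ _ * _ ^+ _)).
      apply: eq_card => i; rewrite !inE unfold_in.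
      by case: (eqVneq i j) => [->|//]; rewrite (eqP aj) /= ltn_eqF.
    rewrite /nlow [in RHS](cardD1 j) inE aj /=.
    by apply: eq_card => i; rewrite !inE.
  rewrite linearZ /= integral01_beta -addnS prednK//; ring.
rewrite (eq_bigr _ (fun j _ => T j)) -big_mkcond /= sumr_const -mulr_natl.
case: ifPn => [/existsP[j aj]|/existsPn na].
  have q0 : (0 < nlow a)%N by apply/card_gt0P; exists j.
  rewrite -beta_weight -[in RHS](prednK q0) factS prednK// natrM; ring.
rewrite (_ : #|_| = 0%N) ?mul0r//; apply: eq_card0 => i.
by apply/negbTE; have := na i; rewrite unfold_in.
Qed.
End Expansions.

Local Open Scope classical_set_scope.
Local Open Scope complex_scope.

(** * Stabilisers of functions under permutations *)

Section StabiliserCount.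
Variables (I : finType) (T : eqType) (f : I -> T).

(** By induction on the size of [A]: for [x] in [A], the image of [x] can be any [y] of
    [A] in the fibre of [x], and composing with the transposition of [x] and [y]
    identifies the permutations sending [x] to [y] with those of [A] minus [x]. *)
Lemma card_fibre_perm_on (s : seq T) (A : {set I}) : uniq s ->
    (forall i, f i \in s) ->
  #|[set p : {perm I} | perm_on A p & [forall i, f (p i) == f i]]%SET| =
  (\prod_(v <- s) (#|[set i in A | f i == v]%SET|)`!)%N.
Proof.
move=> us fs; move: {2}#|A| (erefl #|A|) => m.
elim: m A => [|m IHm] A cA.
  have A0 : A = finset.set0 by apply: cards0_eq.
  rewrite big1_seq => [|v _]; last first.
    by rewrite A0 (_ : #|_| = 0%N)//; apply: eq_card0 => i; rewrite !inE.
  apply/eqP/cards1P; exists 1%g; apply/setP => p; rewrite !inE A0.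
  apply/andP/eqP => [[p1 _]|->].
    by apply/permP => i; rewrite perm1 (out_perm p1)// inE.
  by split; [exact: perm_on1 | apply/forallP => i; rewrite perm1].
have /card_gt0P[x xA] : (0 < #|A|)%N by rewrite cA.
pose B := (A :\ x)%SET.
have cB : #|B| = m by move: cA; rewrite (cardsD1 x) xA => -[].
pose X := [set i in A | f i == f x]%SET.
have count v : #|[set i in A | f i == v]%SET| =
    ((v == f x) + #|[set i in B | f i == v]%SET|)%N.
  rewrite (cardsD1 x) !inE xA /= eq_sym; congr (_ + _)%N; apply: eq_card => i.
  by rewrite !inE andbA.
have fibre y : y \in X ->
  #|[set p : {perm I} | (perm_on A p && [forall i, f (p i) == f i]) && (p x == y)]%SET| =
  #|[set p : {perm I} | perm_on B p & [forall i, f (p i) == f i]]%SET|.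
  rewrite inE => /andP[yA /eqP fyx].
  have ft i : f (tperm x y i) = f i by case: tpermP => // ->.
  have tA : perm_on A (tperm x y).
    apply/fintype.subsetP => i; rewrite inE; case: tpermP => [->|->|]//.
    by rewrite eqxx.
  rewrite -[RHS](card_imset _ (mulIg (tperm x y))); apply: eq_card => p.
  rewrite !inE; apply/andP/imsetP => [[/andP[pA /forallP fp] /eqP px]|[q]].
    exists (p * tperm x y)%g; last by rewrite -mulgA tperm2 mulg1.
    rewrite inE; apply/andP; split.
      apply/fintype.subsetP => i; rewrite inE => pi; rewrite !inE.
      apply/andP; split.
        by apply: contraNneq pi => ->; rewrite permM px tpermR.
      have : (p * tperm x y)%g i != i by [].
      by apply: contraR => iA; rewrite (out_perm (perm_onM pA tA)).
    by apply/forallP => i; rewrite permM ft.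
  rewrite inE => /andP[qB /forallP fq] ->.
  have qA : perm_on A q by apply: fintype.subset_trans qB (subD1set _ _).
  split; first (apply/andP; split).
  - exact: perm_onM.
  - by apply/forallP => i; rewrite permM ft.
  - by rewrite permM (out_perm qB) ?tpermL// !inE eqxx.
have -> : #|[set p : {perm I} | perm_on A p & [forall i, f (p i) == f i]]%SET| =
    (\sum_(y in X) #|[set p : {perm I} |
      (perm_on A p && [forall i, f (p i) == f i]) && (p x == y)]%SET|)%N.
  rewrite -sum1_card (partition_big (fun p : {perm I} => p x) (mem X)) /=.
    by apply: eq_bigr => y _; rewrite -sum1_card; apply: eq_bigl => p; rewrite !inE.
  move=> p; rewrite !inE => /andP[pA /forallP ->].
  by rewrite andbT perm_closed.
rewrite (eq_bigr _ fibre) sum_nat_const IHm//.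
rewrite (bigD1_seq (f x))//= [RHS](bigD1_seq (f x))//= mulnA.
have cX : #|X| = #|[set i in B | f i == f x]%SET|.+1 by rewrite /X count eqxx.
rewrite [in RHS]count eqxx add1n factS -cX; congr (_ * _)%N.
by apply: eq_bigr => v /negPf vx; rewrite count vx.
Qed.

Lemma card_fibre_perm (s : seq T) : uniq s -> (forall i, f i \in s) ->
  #|[set p : {perm I} | [forall i, f (p i) == f i]]%SET| =
  (\prod_(v <- s) (#|[set i | f i == v]%SET|)`!)%N.
Proof.
move=> us fs.
transitivity #|[set p : {perm I} | perm_on [set: I]%SET p & [forall i, f (p i) == f i]]%SET|.
  apply: eq_card => p; rewrite !inE andb_idl// => _.
  by apply/fintype.subsetP => i; rewrite inE.
rewrite (card_fibre_perm_on _ us)//; apply: eq_bigr => v _; congr _`!.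
by apply: eq_card => i; rewrite !inE.
Qed.
End StabiliserCount.

(** * The fundamental alcove *)

Section LevelCount.
Variables (d : nat) (M : int).
Implicit Types k l : 'rV[int]_d.+1.

(** A regularised count of the elements at least [v] in the union of the cosets
    [k_i + M Z]: relative to the choice of [k_i] as origin of its coset, the
    [i]-th coset contributes [floor ((k_i - v) / M) + 1]. *)
Definition level_count k (v : int) : int :=
  \sum_(i < d.+1) (((k 0 i - v)%R %/ M)%Z + 1).

(** Among the vectors with coordinate sum 0, a fundamental domain of the affine Weyl
    group generated by the permutations and by the translations by [M] times the
    integer vectors with coordinate sum 0. *)
Definition alcove k := (forall i j : 'I_d.+1, (i <= j)%N -> k 0 j <= k 0 i) /\
  k 0 ord0 <= k 0 ord_max + M.

Lemma alcove_spread k (i j : 'I_d.+1) : alcove k -> k 0 i <= k 0 j + M.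
Proof.
move=> [mono sp]; have := mono ord0 i (leq0n _); have := mono j ord_max (leq_ord j).
by lia.
Qed.

Hypothesis M0 : 0 < M.

(** The coordinates of [k] differ by at most [M], which bounds the summands on both
    sides of the rank [r].  If [v <= k_r] the ranks up to [r] contribute at least 1
    each and the others at least 0; otherwise the ranks before [r] contribute at
    most 1 each and the others at most 0. *)
Lemma alcove_level_count k v (r : 'I_d.+1) : alcove k ->
  (v <= k 0 r) = (r%:Z < level_count k v).
Proof.
move=> ak; have [mono _] := ak.
have sumI m : (m <= d.+1)%N -> \sum_(i < d.+1) ((i < m)%N%:R : int) = m%:Z.
  move=> md; rewrite -natr_sum natz; congr Posz.
  by rewrite (eq_bigr (fun i : 'I_d.+1 => if (i < m)%N then 1%N else 0%N)) => [|i _];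
    [rewrite -big_mkcond (big_ord_narrow md) sum1_card card_ord | case: ltnP].
have spread (i j : 'I_d.+1) := alcove_spread i j ak.
have eq_floor (i : 'I_d.+1) :
    k 0 i - v = ((k 0 i - v)%R %/ M)%Z * M + ((k 0 i - v)%R %% M)%Z.
  exact: divz_eq.
have mod0 (i : 'I_d.+1) : 0 <= ((k 0 i - v)%R %% M)%Z by rewrite modz_ge0// gt_eqF.
have modM (i : 'I_d.+1) : ((k 0 i - v)%R %% M)%Z < M by rewrite ltz_pmod.
apply/idP/idP => [vr|].
  suff : (r.+1)%:Z <= level_count k v by lia.
  rewrite -(sumI _ (ltn_ord r)); apply: ler_sum => i _.
  have := eq_floor i; have := mod0 i; have := modM i; have := spread r i.
  case: ltnP => [ir|_]; last by set q := (_ %/ _)%Z; nia.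
  by have := mono i r ir; set q := (_ %/ _)%Z; nia.
apply: contraTT; rewrite -ltNge -leNgt => rv.
rewrite -(sumI _ (ltnW (ltn_ord r))); apply: ler_sum => i _.
have := eq_floor i; have := mod0 i; have := modM i; have := spread i r.
case: ltnP => [_|ri]; first by set q := (_ %/ _)%Z; nia.
by have := mono r i ri; set q := (_ %/ _)%Z; nia.
Qed.

(** Translating the entries by multiples [q_i M] changes the count by the sum of the
    [q_i], which is 0 because the coordinate sums agree. *)
Lemma level_count_congr k l (p : 'S_d.+1) v :
  \sum_(i < d.+1) k 0 i = \sum_(i < d.+1) l 0 i ->
  (forall i : 'I_d.+1, (l 0%R i = k 0%R (p i) %[mod M])%Z) ->
  level_count l v = level_count k v.
Proof.
move=> skl lk; pose q (i : 'I_d.+1) := (l 0%R i %/ M)%Z - (k 0%R (p i) %/ M)%Z.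
have lE (i : 'I_d.+1) : l 0 i = k 0 (p i) + q i * M.
  by rewrite (divz_eq (l 0 i) M) lk {2}(divz_eq (k 0 (p i)) M) /q; ring.
have q0 : \sum_i q i = 0.
  apply: (mulIf (lt0r_neq0 M0)); rewrite mul0r mulr_suml.
  rewrite (eq_bigr (fun i => l 0 i - k 0 (p i))) => [|i _]; last by rewrite lE addrC addKr.
  by rewrite sumrB -skl [X in X - _](reindex_inj (@perm_inj _ p)) subrr.
rewrite /level_count [RHS](reindex_inj (@perm_inj _ p)) /=.
rewrite (eq_bigr (fun i => ((k 0 (p i) - v)%R %/ M)%Z + 1 + q i)) => [|i _].
  by rewrite big_split /= q0 addr0.
rewrite lE (_ : k 0 (p i) + q i * M - v = k 0 (p i) - v + q i * M); last by ring.
by rewrite divzDr ?dvdz_mull// mulzK ?gt_eqF// addrAC.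
Qed.

(** The sorted coordinates are recovered from [level_count], which is invariant
    under permutations and under the translations by multiples of [M]. *)
Lemma alcove_unique k l (p : 'S_d.+1) : alcove k -> alcove l ->
  \sum_(i < d.+1) k 0 i = \sum_(i < d.+1) l 0 i ->
  (forall i : 'I_d.+1, (l 0%R i = k 0%R (p i) %[mod M])%Z) -> k = l.
Proof.
move=> ak al skl lk; apply/rowP => r; apply/le_anti/andP; split.
  by rewrite (alcove_level_count _ _ al) (level_count_congr _ skl lk) -alcove_level_count.
by rewrite (alcove_level_count _ _ ak) -(level_count_congr _ skl lk) -alcove_level_count.
Qed.
End LevelCount.

(** * Index sets and weights *)

Section Alcove.
Variables (d n : nat).
Implicit Types (k : 'rV[int]_d.+1) (s : 'S_d.+1).
Local Notation M := ((d.+1 * n)%N%:Z).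

Lemma HstarP k : Hstar d n k <-> HH d k /\ forall i j : 'I_d.+1, k 0 i - k 0 j <= M.
Proof.
have cmp (z : int) : (z%:~R / d.+1%:R <= n%:R :> rat) = (z <= M).
  by rewrite ler_pdivrMr ?ltr0n// -natrM mulnC -[_%:R]/(_%:Z%:~R) ler_int.
have cmpN (z : int) : (- n%:R <= z%:~R / d.+1%:R :> rat) = (- z <= M).
  by rewrite lerNl -mulNr -rmorphN /= cmp.
split=> -[hk h]; split=> // i j.
  case: (ltngtP i j) => [/h|/h|/val_inj->]; last by rewrite subrr.
  - by rewrite cmp cmpN => /andP[].
  - by rewrite cmp cmpN opprB => /andP[].
by move=> _; rewrite cmp cmpN opprB !h.
Qed.

Lemma HH_col_perm s k : HH d k -> HH d (col_perm s k).
Proof.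
move=> [k0 km]; split=> [|i j]; last by rewrite !mxE; exact: km.
transitivity (\sum_i k 0 i) => //; rewrite [RHS](reindex_inj (@perm_inj _ s)).
by apply: eq_bigr => i _; rewrite mxE.
Qed.

Lemma Hstar_col_perm s k : Hstar d n k -> Hstar d n (col_perm s k).
Proof.
move=> /HstarP[hk h]; apply/HstarP; split; first exact: HH_col_perm.
by move=> i j; rewrite !mxE.
Qed.

Lemma Lambda_alcove k : Lambda d n k <-> HH d k /\ alcove M k.
Proof. by split=> [[? ? ?]|[? [? ?]]]; split. Qed.

Lemma Lambda_Hstar k : Lambda d n k -> Hstar d n k.
Proof.
move=> /Lambda_alcove[hk ak]; apply/HstarP; split=> // i j.
by rewrite lerBlDl (alcove_spread i j ak).
Qed.

Lemma Hstar_sort k : Hstar d n k -> exists s, Lambda d n (col_perm s k).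
Proof.
move=> hk; pose t := [tuple k 0 i | i < d.+1].
have [s sE] : exists s : 'S_d.+1, sort >=%R t = [tuple tnth t (s i) | i < d.+1].
  by apply/tuple_permP; rewrite perm_sort.
exists s; apply/Lambda_alcove; have /HstarP[hh hb] := Hstar_col_perm s hk.
split=> //; split; last by rewrite -lerBlDl hb.
have snth (i : 'I_d.+1) : nth 0 (sort >=%R t) i = (col_perm s k) 0 i.
  by rewrite sE -tnth_nth tnth_mktuple tnth_mktuple mxE.
move=> i j ij; rewrite -!snth.
have total_ge : total (>=%R : rel int) by move=> x y; exact: le_total.
have tr : transitive (>=%R : rel int) by move=> x y z yx xz; exact: le_trans xz yx.
have rf : reflexive (>=%R : rel int) by move=> x; exact: le_refl.
by apply: (sorted_leq_nth tr rf 0 (sort_sorted total_ge t)) => //;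
  rewrite inE size_sort size_tuple.
Qed.

Lemma Lambda_unique k k' s : (0 < n)%N -> Lambda d n k -> Lambda d n k' ->
  (forall i, (k' 0%R i = k 0%R (s i) %[mod M])%Z) -> k = k'.
Proof.
move=> n0 /Lambda_alcove[[k0 _] ak] /Lambda_alcove[[k'0 _] ak'].
by apply: (alcove_unique _ ak ak'); rewrite ?k0 ?k'0// ltz_nat muln_gt0.
Qed.

Lemma mult_col_perm s k v : mult (col_perm s k) v = mult k v.
Proof.
rewrite /mult -(card_imset _ (@perm_inj _ s)); apply: eq_card => i.
apply/imsetP/idP => [[j]|]; rewrite inE.
  by rewrite mxE => kj ->; rewrite inE.
by move=> ki; exists (s^-1%g i); rewrite ?inE ?mxE permKV.
Qed.

Lemma kmax_eq k (i : 'I_d.+1) : (forall j, k 0 j <= k 0 i) -> kmax k = k 0 i.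
Proof.
move=> h; apply/le_anti/andP; split; last exact: le_bigmax.
by apply: bigmax_le => // j _; exact: h.
Qed.

Lemma kmin_eq k (i : 'I_d.+1) : (forall j, k 0 i <= k 0 j) -> kmin k = k 0 i.
Proof.
move=> h; apply/le_anti/andP; split; first exact: bigmin_le.
by apply: le_bigmin => // j _; exact: h.
Qed.

Lemma kmaxP k : exists2 i, kmax k = k 0 i & forall j, k 0 j <= k 0 i.
Proof.
have [i _ h] := @Order.TotalTheory.arg_maxP _ _ _ (ord0 : 'I_d.+1) xpredT (fun i => k 0 i) isT.
by exists i => [|j]; [apply: kmax_eq => j|]; exact: h.
Qed.

Lemma kminP k : exists2 i, kmin k = k 0 i & forall j, k 0 i <= k 0 j.
Proof.
have [i _ h] := @Order.TotalTheory.arg_minP _ _ _ (ord0 : 'I_d.+1) xpredT (fun i => k 0 i) isT.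
by exists i => [|j]; [apply: kmin_eq => j|]; exact: h.
Qed.

Lemma kmax_col_perm s k : kmax (col_perm s k) = kmax k.
Proof.
have [i -> h] := kmaxP k; rewrite (@kmax_eq _ (s^-1%g i)) ?mxE ?permKV// => j.
by rewrite !mxE ?permKV.
Qed.

Lemma kmin_col_perm s k : kmin (col_perm s k) = kmin k.
Proof.
have [i -> h] := kminP k; rewrite (@kmin_eq _ (s^-1%g i)) ?mxE ?permKV// => j.
by rewrite !mxE ?permKV.
Qed.

Lemma cweight_col_perm (R : realType) s k :
  cweight R n (col_perm s k) = cweight R n k.
Proof. by rewrite /cweight kmax_col_perm kmin_col_perm !mult_col_perm. Qed.

Definition stab k := #|[set s : 'S_d.+1 | [forall i, k 0%R (s i) == k 0%R i]]%SET|.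

Definition stabmod k :=
  #|[set s : 'S_d.+1 | [forall i, (k 0%R (s i) == k 0%R i %[mod M])%Z]]%SET|.

Lemma mem_values k (i : 'I_d.+1) : k 0 i \in values k.
Proof. by rewrite mem_undup; apply/mapP; exists i; rewrite ?mem_enum. Qed.

Lemma stabE k : stab k = (\prod_(v <- values k) (mult k v)`!)%N.
Proof. by apply: card_fibre_perm (undup_uniq _) (mem_values k). Qed.

Lemma natr_gt0_neq0 (F : numDomainType) m : (0 < m)%N -> m%:R != 0 :> F.
Proof. by rewrite pnatr_eq0 -lt0n. Qed.

Lemma stab_gt0 k : (0 < stab k)%N.
Proof. by rewrite stabE big_seq prodn_cond_gt0// => v _; rewrite fact_gt0. Qed.

Lemma Lambda_kmax k : Lambda d n k -> kmax k = k 0 ord0.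
Proof. by case=> _ h _; apply: kmax_eq => j; apply: h. Qed.

Lemma Lambda_kmin k : Lambda d n k -> kmin k = k 0 ord_max.
Proof. by case=> _ h _; apply: kmin_eq => j; apply: h; exact: leq_ord. Qed.

Lemma prod_values_boundary k : k 0 ord0 != k 0 ord_max -> forall G : int -> nat,
  (\prod_(v <- values k) G v = G (k 0%R ord0) * G (k 0%R ord_max) *
    \prod_(v <- values k | (v != k 0%R ord0) && (v != k 0%R ord_max)) G v)%N.
Proof.
move=> ne G; rewrite (bigD1_seq (k 0 ord0)) ?mem_values ?undup_uniq//= -mulnA.
congr (_ * _)%N.
rewrite [LHS]big_mkcond (bigD1_seq (k 0 ord_max)) ?mem_values ?undup_uniq//= eq_sym ne.
congr (_ * _)%N; rewrite [RHS]big_mkcond [LHS]big_mkcond.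
by apply: eq_bigr => v _; do 2 case: eqP.
Qed.

(** The orbit of [k] has [(d+1)! / stab k] elements, so this is the equality of
    [lambda_k] with [c_k] times the size of the orbit.  On the boundary,
    [c_k = p! q! / (p+q)!] merges the factorials of the multiplicities of the
    largest and of the smallest coordinate. *)
Lemma lambda_stab (R : realType) k : (0 < n)%N -> Lambda d n k ->
  lambda R n k * (stab k)%:R = d.+1`!%:R * cweight R n k.
Proof.
move=> n0 lk; have nz m : (m`!)%:R != 0 :> R[i] by rewrite natr_gt0_neq0 ?fact_gt0.
rewrite /lambda /cweight Lambda_kmax// Lambda_kmin// ltrBlDl.
case: ifPn => [_|]; first by rewrite -stabE mulfVK ?mulr1// natr_gt0_neq0 ?stab_gt0.
rewrite -leNgt => h.
have ne : k 0 ord0 != k 0 ord_max by lia.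
have := stab_gt0 k; rewrite stabE prod_values_boundary//.
set P := (\prod_(_ <- _ | _) _)%N; set p := mult _ _; set q := mult _ _.
rewrite !muln_gt0 => /andP[_ P0].
have := bin_fact (leq_addr q p); rewrite addKn => <-.
have b0 : 'C(p + q, p)%:R != 0 :> R[i] by rewrite natr_gt0_neq0// bin_gt0 leq_addr.
by rewrite !natrM; field; rewrite b0 !nz natr_gt0_neq0.
Qed.

(** Modulo [(d+1) n] the distinct coordinates of [k] remain distinct, except that on
    the boundary the largest and the smallest one are identified. *)
Lemma lambda_stabmod (R : realType) k : (0 < n)%N -> Lambda d n k ->
  lambda R n k * (stabmod k)%:R = d.+1`!%:R.
Proof.
move=> n0 lk; have [_ ak] := (Lambda_alcove k).1 lk.
have M0 : 0 < M by rewrite ltz_nat muln_gt0.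
have spread (i j : 'I_d.+1) := alcove_spread i j ak.
have mono : forall i : 'I_d.+1, k 0 ord_max <= k 0 i <= k 0 ord0.
  by case: ak => mono _ i; rewrite !mono// leq_ord.
have modE (x y : int) : `|x - y| < M -> (x == y %[mod M])%Z = (x == y).
  move=> xy; rewrite eqz_mod_dvd; apply/idP/eqP => [/dvdzP[q]|->].
    by move=> E; have : q = 0 by [nia]; lia.
  by rewrite subrr dvdz0.
rewrite /lambda; case: ifPn => [lt|].
  have -> : stabmod k = stab k.
    rewrite /stab /stabmod; apply: eq_card => s; rewrite !inE; apply: eq_forallb => i.
    by rewrite modE//; have := mono i; have := mono (s i); lia.
  by rewrite -stabE mulfVK ?mulr1// natr_gt0_neq0 ?stab_gt0.
rewrite -leNgt => h; have kE : k 0 ord0 = k 0 ord_max + M.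
  by have := spread ord0 ord_max; lia.
have ne : k 0 ord0 != k 0 ord_max by lia.
(* [f] takes equal values exactly at the coordinates that are congruent. *)
pose f (i : 'I_d.+1) := if k 0 i == k 0 ord_max then k 0 ord0 else k 0 i.
have -> : stabmod k = #|[set s : 'S_d.+1 | [forall i, f (s i) == f i]]%SET|.
  apply: eq_card => s; rewrite !inE; apply: eq_forallb => i.
  have fm (j : 'I_d.+1) : (k 0%R j = f j %[mod M])%Z.
    by rewrite /f; case: eqP => // ->; rewrite kE modzDr.
  rewrite fm (fm i) modE// /f; have := mono i; have := mono (s i).
  by do 2 case: eqP; lia.
rewrite (card_fibre_perm (undup_uniq [seq k 0 i | i : 'I_d.+1])); last first.
  by move=> i; rewrite /f; case: ifP => _; exact: mem_values.
rewrite (prod_values_boundary ne (fun v => (#|[set i | f i == v]%SET|)`!)).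
have -> : #|[set i | f i == k 0 ord0]%SET| =
    (mult k (k 0%R ord0) + mult k (k 0%R ord_max))%N.
  rewrite /mult -cardsUI (_ : finset.setI _ _ = finset.set0) ?cards0 ?addn0.
    by apply: eq_card => i; rewrite !inE /f; case: (eqVneq (k 0 i) (k 0 ord_max)) => [->|_];
      rewrite ?eqxx ?orbT ?orbF.
  by apply/setP => i; rewrite !inE; apply/negP => /andP[/eqP -> ]; apply/negP.
have -> : #|[set i | f i == k 0 ord_max]%SET| = 0%N.
  by apply: eq_card0 => i; rewrite !inE /f; case: ifPn => [_|]; apply/negbTE.
rewrite fact0 muln1.
rewrite [X in _ * (_ * X)%N%:R](eq_bigr (fun v => (mult k v)`!)) => [|v /andP[v0 vm]].
  rewrite mulfVK// natr_gt0_neq0// muln_gt0 fact_gt0 prodn_cond_gt0// => v _.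
  exact: fact_gt0.
congr (_`!); apply: eq_card => i; rewrite !inE /f.
case: (eqVneq (k 0 i) (k 0 ord_max)) => // ->.
by rewrite [LHS]eq_sym [RHS]eq_sym (negPf v0) (negPf vm).
Qed.

End Alcove.

(** * Exponentials and generalized cosines *)

Section Expi.
Variable R : realType.
Implicit Types x y : R.

Lemma expi0 : expi 0 = 1 :> R[i].
Proof. by rewrite /expi cos0 sin0. Qed.

Lemma expiD x y : expi (x + y) = expi x * expi y.
Proof.
by rewrite /expi cosD sinD; apply/eqP; rewrite eq_complex /= eqxx /= addrC.
Qed.

Lemma expiN x : expi (- x) = (expi x)^*%R.
Proof. by rewrite /expi cosN sinN. Qed.

Lemma expiNK x : expi x * expi (- x) = 1.
Proof. by rewrite -expiD subrr expi0. Qed.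

Lemma expi_neq0 x : expi x != 0.
Proof.
by apply/eqP => h; have := expiNK x; rewrite h mul0r => /esym/eqP; rewrite oner_eq0.
Qed.

Lemma expiV x : expi (- x) = (expi x)^-1.
Proof. by apply: (mulfI (expi_neq0 x)); rewrite expiNK mulfV// expi_neq0. Qed.

Lemma expi_sum (J : finType) (P : pred J) (f : J -> R) :
  expi (\sum_(i | P i) f i) = \prod_(i | P i) expi (f i).
Proof. exact: (big_morph _ expiD expi0). Qed.

Lemma expiMn x m : expi (x * m%:R) = expi x ^+ m.
Proof.
elim: m => [|m IHm]; first by rewrite mulr0 expi0.
by rewrite -natr1 mulrDr mulr1 expiD IHm exprSr.
Qed.

Lemma expi_2piz (z : int) : expi (2 * pi * z%:~R) = 1 :> R[i].
Proof.
have nat1 m : expi (2 * pi * m%:R) = 1 :> R[i].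
  by rewrite expiMn /expi mulr_natl cos2pi sin2pi expr1n.
case: (intP z) => [|m|m]; first by rewrite mulr0 expi0.
- exact: nat1.
- by rewrite rmorphN mulrN expiV nat1 invr1.
Qed.

(** The fractional part [y] of [x] satisfies [sin (pi y) = 0] with [0 <= y < 1]. *)
Lemma expi_2pi_eq1 x : expi (2 * pi * x) = 1 -> exists z : int, x = z%:~R.
Proof.
move=> h; pose y := x - (Num.floor x)%:~R.
have y0 : 0 <= y by rewrite subr_ge0 floor_le.
have y1 : y < 1 by rewrite ltrBlDl; have := floorD1_gt x; rewrite rmorphD.
have hy : expi (2 * pi * y) = 1.
  by rewrite /y mulrBr expiD expiV expi_2piz h invr1 mulr1.
have sy : sin (pi * y) = 0.
  have [+ _] := hy; rewrite -mulrA mulr_natl cos_mulr2n => c1.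
  by apply/eqP; rewrite -sqrf_eq0 sin2cos2; apply/eqP; lra.
exists (Num.floor x); apply/eqP; rewrite -subr_eq0 -/y; apply/negPn/negP => yn0.
have yp : 0 < y by rewrite lt_neqAle eq_sym yn0.
have : 0 < sin (pi * y).
  by apply: sin_gt0_pi; rewrite ?mulr_gt0 ?pi_gt0//= gtr_pMr ?pi_gt0.
by rewrite sy ltxx.
Qed.

End Expi.

Section Characters.
Variables (R : realType) (d : nat).
Implicit Types (t : 'rV[R]_d.+1) (k l j : 'rV[int]_d.+1) (s : 'S_d.+1).

Lemma phiD k l t : phi (k + l) t = phi k t * phi l t.
Proof.
rewrite /phi -expiD -mulrDr -big_split; congr (expi (_ * _)).
by apply: eq_bigr => i _; rewrite mxE rmorphD mulrDl.
Qed.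

Lemma phiN k t : phi (- k) t = (phi k t)^*%R.
Proof.
rewrite /phi -expiN -mulrN -sumrN; congr (expi (_ * _)).
by apply: eq_bigr => i _; rewrite mxE rmorphN mulNr.
Qed.

Lemma phiB_arg k (t u : 'rV[R]_d.+1) : phi k (t - u) = phi k t * (phi k u)^*%R.
Proof.
rewrite /phi -expiN -expiD -mulrN -mulrDr -sumrN -big_split; congr (expi (_ * _)).
by apply: eq_bigr => i _; rewrite !mxE mulrBr.
Qed.

Lemma phi_col_perm s k t : phi k (col_perm s t) = phi (col_perm s^-1 k) t.
Proof.
rewrite /phi; congr (expi (_ * _)); rewrite [RHS](reindex_inj (@perm_inj _ s)).
by apply: eq_bigr => i _; rewrite !mxE permK.
Qed.

Lemma TC_sum_index k t :
  TC k t = d.+1`!%:R^-1 * \sum_(s : 'S_d.+1) phi (col_perm s k) t.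
Proof.
rewrite /TC /Pplus; congr (_ * _); rewrite [LHS](reindex_inj invg_inj).
by apply: eq_bigr => s _; rewrite phi_col_perm invgK.
Qed.

Lemma TC_col_perm s k t : TC k (col_perm s t) = TC k t.
Proof.
rewrite /TC /Pplus; congr (_ * _).
rewrite [RHS](reindex_inj (@mulIg _ s)).
by apply: eq_bigr => s' _; rewrite col_permM.
Qed.

Lemma node_col_perm n s j : node R n (col_perm s j) = col_perm s (node R n j).
Proof. by apply/rowP => i; rewrite !mxE. Qed.

(** Index and node enter through the same bilinear form; this symmetry turns
    orthogonality over the nodes into orthogonality over the indices. *)
Lemma phi_nodeC n k j : phi k (node R n j) = phi j (node R n k).
Proof.
rewrite /phi; congr (expi (_ * _)); apply: eq_bigr => i _; rewrite !mxE; ring.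
Qed.

Lemma TC_nodeC n k j : TC k (node R n j) = TC j (node R n k).
Proof.
rewrite TC_sum_index /TC /Pplus; congr (_ * _).
by apply: eq_bigr => s _; rewrite phi_nodeC node_col_perm.
Qed.

Lemma node_RH n j : HH d j -> RH R d (node R n j).
Proof.
move=> [j0 _]; rewrite /RH /=; under eq_bigr => i _ do rewrite mxE.
by rewrite -mulr_suml -rmorph_sum /= j0 mul0r.
Qed.

End Characters.

(** * Weighted sums and discrete orthogonality *)

Section WeightedSums.
Variables (R : realType) (d n : nat).
Hypothesis n0 : (0 < n)%N.
Implicit Types (t : 'rV[R]_d.+1) (k l j : 'rV[int]_d.+1) (s : 'S_d.+1).
Local Notation M := ((d.+1 * n)%N%:Z).
Local Notation HS := (fset_set (Hstar d n)).
Local Notation LS := (fset_set (Lambda d n)).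

Lemma mem_Hstar_fset k : (k \in HS) <-> Hstar d n k.
Proof. by rewrite (in_fset_set (@finite_Hstar d n)); split=> [/set_mem|/mem_set]. Qed.

Lemma mem_Lambda_fset k : (k \in LS) <-> Lambda d n k.
Proof. by rewrite (in_fset_set (@finite_Lambda d n)); split=> [/set_mem|/mem_set]. Qed.

(** Each [k'] of the index set is a permutation of exactly one [k] of [Lambda], in
    [stab k] ways, and [lambda_k * stab k / (d+1)! = c_k]. *)
Lemma sum_Hstar (G : 'rV[int]_d.+1 -> R[i]) :
  \sum_(k <- HS) cweight R n k * G k =
  \sum_(k <- LS) lambda R n k / d.+1`!%:R * \sum_(s : 'S_d.+1) G (col_perm s k).
Proof.
have spread k s : k \in LS -> G (col_perm s k) =
    \sum_(k' <- HS) (col_perm s k == k')%:R * G k'.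
  move=> /mem_Lambda_fset/Lambda_Hstar/(Hstar_col_perm s)/mem_Hstar_fset h.
  rewrite (bigD1_seq _ h (fset_uniq _))//= eqxx mul1r big1 ?addr0// => k'.
  by rewrite eq_sym => /negPf ->; rewrite mul0r.
transitivity (\sum_(k <- LS) lambda R n k / d.+1`!%:R *
    \sum_(s : 'S_d.+1) \sum_(k' <- HS) (col_perm s k == k')%:R * G k'); last first.
  rewrite big_seq [RHS]big_seq; apply: eq_bigr => k kL; congr (_ * _).
  by apply: eq_bigr => s _; rewrite -spread.
under [RHS]eq_bigr => k _ do rewrite exchange_big /= mulr_sumr.
rewrite exchange_big /= big_seq [RHS]big_seq; apply: eq_bigr => k' k'H.
under [RHS]eq_bigr => k _ do rewrite -mulr_suml mulrA.
rewrite -mulr_suml; congr (_ * _).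
have /Hstar_sort[s0 /mem_Lambda_fset k0L] := (mem_Hstar_fset k').1 k'H.
set k0 := col_perm s0 k' in k0L.
rewrite (bigD1_seq _ k0L (fset_uniq _))//=.
rewrite [X in _ + X]big1_seq ?addr0 => [|k /andP[kk0 kin]]; last first.
  have kL : Lambda d n k by apply/mem_Lambda_fset.
  rewrite big1 ?mulr0// => s _; case: eqP => // ks; case/eqP: kk0.
  apply: (@Lambda_unique _ _ _ _ (s0 * s)%g n0 kL) => [|i]; first exact/mem_Lambda_fset.
  by rewrite /k0 -ks !mxE permM.
have -> : \sum_(s : 'S_d.+1) (col_perm s k0 == k')%:R = (stab k0)%:R :> R[i].
  rewrite (reindex_inj (mulgI s0^-1%g)) /= -natr_sum /stab -sum1_card; congr _%:R.
  rewrite [RHS]big_mkcond; apply: eq_bigr => s _; rewrite inE; congr (nat_of_bool _).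
  apply/eqP/forallP => [/rowP h i|h]; last apply/rowP => i.
    by have := h (s0 i); rewrite !mxE permM permK => ->.
  by have /eqP := h (s0^-1%g i); rewrite !mxE permM permKV.
rewrite mulrAC (lambda_stab R n0 ((mem_Lambda_fset k0).1 k0L)).
rewrite mulrAC mulfV ?mul1r; last by rewrite natr_gt0_neq0 ?fact_gt0.
by rewrite cweight_col_perm.
Qed.

(** The elements of [HH] are the projections of the integer vectors to the
    hyperplane, scaled by [d+1]; the projection forgets the addition of a constant
    vector, which is normalised by asking for a smallest entry 0. *)
Definition lattice_point (a : {ffun 'I_d.+1 -> 'I_n.+1}) : 'rV[int]_d.+1 :=
  \row_i (d.+1%:Z * (a i : nat)%:Z - \sum_j (a j : nat)%:Z).

Let has0 (a : {ffun 'I_d.+1 -> 'I_n.+1}) := [exists i, a i == 0%N :> nat].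

Lemma lattice_point_HH a : HH d (lattice_point a).
Proof.
split=> [|i j].
  rewrite (eq_bigr _ (fun i _ => mxE _ _ _ _)) /= sumrB -mulr_sumr sumr_const card_ord.
  by rewrite -[X in _ - X]mulr_natl natz subrr.
rewrite !mxE; apply/eqP; rewrite eqz_mod_dvd opprB addrA subrK -mulrBr.
exact: dvdz_mulr.
Qed.

Lemma lattice_point_Hstar a : Hstar d n (lattice_point a).
Proof.
apply/HstarP; split=> [|i j]; first exact: lattice_point_HH.
rewrite !mxE; have := ltn_ord (a i); have := ltn_ord (a j).
by set S := \sum_(_ | _) _; nia.
Qed.

Lemma lattice_point_inj : {in has0 &, injective lattice_point}.
Proof.
move=> a b /existsP[i0 /eqP ai0] /existsP[j0 /eqP bj0] /rowP ab.
apply/ffunP => i; apply/val_inj => /=.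
have := ab i0; have := ab j0; have := ab i; rewrite !mxE ai0 bj0.
by set S := \sum_(_ | _) _; set S' := \sum_(_ | _) _; nia.
Qed.

Lemma lattice_point_surj k : Hstar d n k -> exists2 a, has0 a & k = lattice_point a.
Proof.
move=> /HstarP[[k0 km] hb]; have [i0 _ hi0] := kminP k.
have dv i : exists2 m : nat, (m <= n)%N & k 0 i - k 0 i0 = d.+1%:Z * m%:Z.
  have /eqP := km i i0; rewrite eqz_mod_dvd => /dvdzP[q E].
  have {}E : k 0 i - k 0 i0 = q * d.+1%:Z by [].
  have h1 := hb i i0; have h2 := hi0 i.
  have q0 : 0 <= q by nia.
  have qn : q <= n%:Z by nia.
  by exists `|q|%N; first lia; rewrite E; nia.
pose a := [ffun i : 'I_d.+1 => inord (s2val (cid2 (dv i))) : 'I_n.+1].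
have aE i : k 0 i - k 0 i0 = d.+1%:Z * (a i : nat)%:Z.
  by rewrite ffunE; case: cid2 => m mn /= ->; rewrite inordK.
exists a.
  apply/existsP; exists i0; have := aE i0; rewrite subrr.
  by set m := nat_of_ord _; case: m => // m; lia.
have S : k 0 i0 = - \sum_j (a j : nat)%:Z.
  have : \sum_i (k 0 i - k 0 i0) = \sum_i d.+1%:Z * (a i : nat)%:Z.
    by apply: eq_bigr => i _.
  rewrite sumrB k0 sumr_const card_ord -mulr_natl -mulr_sumr.
  by set S := \sum_(_ | _) _; nia.
by apply/rowP => i; rewrite mxE -aE -S; ring.
Qed.

Lemma phi_lattice_point a t : RH R d t ->
  phi (lattice_point a) t = \prod_i expi (2 * pi * t 0 i) ^+ a i.
Proof.
move=> t0; rewrite /phi -(eq_bigr _ (fun i _ => expiMn _ _)) -expi_sum; congr expi.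
under eq_bigr => i _ do rewrite mxE rmorphB mulrBl /=.
rewrite sumrB -mulr_sumr t0 mulr0 subr0 mulr_sumr; apply: eq_bigr => i _.
rewrite rmorphM /= -[d.+1%:~R]/(d.+1%:R) -[(a i : nat)%:~R]/((a i)%:R).
by field; rewrite nat1r natr_gt0_neq0.
Qed.

Lemma cweight_lattice_point a : has0 a ->
  cweight R n (lattice_point a) = 'C(nhigh a + nlow a, nhigh a)%:R^-1.
Proof.
move=> /existsP[i0 /eqP ai0]; have [i1 k1 h1] := kmaxP (lattice_point a).
have k0 : kmin (lattice_point a) = lattice_point a 0 i0.
  by apply: kmin_eq => j; rewrite !mxE ai0; set S := \sum_(_ | _) _; nia.
have a1 (j : 'I_d.+1) : (a j <= a i1)%N.
  by have := h1 j; rewrite !mxE; set S := \sum_(_ | _) _; nia.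
have low : mult (lattice_point a) (kmin (lattice_point a)) = nlow a.
  rewrite k0 /mult /nlow; apply: eq_card => i; rewrite !inE !mxE ai0.
  by rewrite (inj_eq (addIr _)) (inj_eq (@mulfI _ d.+1%:Z isT)).
rewrite /cweight low k1 k0 !mxE ai0.
have := ltn_ord (a i1); rewrite ltnS leq_eqVlt => /predU1P[an|an].
  rewrite ifF; last by set S := \sum_(_ | _) _; rewrite an; nia.
  rewrite div1r.
  suff -> : mult (lattice_point a)
    (d.+1%:Z * (a i1 : nat)%:Z - \sum_j (a j : nat)%:Z) = nhigh a by [].
  rewrite /mult /nhigh; apply: eq_card => i; rewrite !inE !mxE an.
  by rewrite (inj_eq (addIr _)) (inj_eq (@mulfI _ d.+1%:Z isT)).
rewrite ifT; last by set S := \sum_(_ | _) _; nia.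
rewrite (_ : nhigh a = 0%N) ?bin0 ?invr1//; apply: eq_card0 => i; rewrite inE.
by apply/negbTE; rewrite neq_ltn (leq_ltn_trans (a1 i) an).
Qed.

Lemma sum_Hstar_phi t : RH R d t ->
  \sum_(k <- HS) cweight R n k * phi k t =
  interp_kernel n (fun i => expi (2 * pi * t 0 i)).
Proof.
move=> t0; rewrite interp_kernel_expansion//.
have pe : perm_eq HS [seq lattice_point a | a <- enum has0].
  apply: uniq_perm; first exact: fset_uniq.
    rewrite map_inj_in_uniq ?enum_uniq// => a b; rewrite !mem_enum.
    exact: lattice_point_inj.
  move=> k.
  apply/idP/mapP => [/mem_Hstar_fset/lattice_point_surj[a a0 ->]|[a _ ->]].
    by exists a; rewrite ?mem_enum.
  exact/mem_Hstar_fset/lattice_point_Hstar.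
rewrite (perm_big _ pe) big_map big_enum /=; apply: eq_bigr => a a0.
by rewrite cweight_lattice_point// phi_lattice_point.
Qed.

(** By the symmetry of node and index this is the value of [(d+1) n^d Phi*_n] at the
    node of [m].  There, all coordinates of [m] being congruent modulo [d+1], the
    numbers [x_i^n = exp (2 pi i m_i / (d+1))] coincide. *)
Lemma phi_discrete_orthogonality (m : 'rV[int]_d.+1) : HH d m ->
  \sum_(j <- HS) cweight R n j * phi m (node R n j) =
  if [forall i, (m 0%R i == 0 %[mod M])%Z] then (d.+1 * n ^ d)%N%:R else 0.
Proof.
move=> hm; have [m0 mm] := hm.
under eq_bigr => j _ do rewrite phi_nodeC.
rewrite sum_Hstar_phi; last exact: node_RH.
have M0 : (d.+1 * n)%N%:R != 0 :> R by rewrite natr_gt0_neq0// muln_gt0.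
case: ifPn => [/forallP h|/forallPn[i0 hi0]].
  transitivity (interp_kernel n (fun _ : 'I_d.+1 => 1 : R[i])); last first.
    by rewrite interp_kernel1 card_ord.
  congr interp_kernel; apply/funext => i; rewrite mxE.
  have := h i; rewrite eqz_mod_dvd subr0 => /dvdzP[q ->].
  by rewrite rmorphM /= -[(d.+1 * n)%N%:~R]/((d.+1 * n)%N%:R) mulfK// expi_2piz.
apply: (@interp_kernel0 _ _ _ _ (expi (2 * pi * (m 0 ord0)%:~R / d.+1%:R))) => [|i|h].
- by rewrite -expi_sum -mulr_sumr (node_RH R n hm) mulr0 expi0.
- rewrite -expiMn mxE.
  have /eqP := mm i ord0; rewrite eqz_mod_dvd => /dvdzP[q E].
  have -> : m 0 i = m 0 ord0 + q * d.+1%:Z by rewrite -E; ring.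
  rewrite rmorphD rmorphM /= -[d.+1%:~R]/(d.+1%:R) natrM.
  have -> : 2 * pi * (((m 0 ord0)%:~R + q%:~R * d.+1%:R) / (d.+1%:R * n%:R)) * n%:R =
    2 * pi * (m 0 ord0)%:~R / d.+1%:R + 2 * pi * q%:~R :> R.
    by field; rewrite nat1r !natr_gt0_neq0.
  by rewrite expiD expi_2piz mulr1.
- case/negP: hi0; have [z] := expi_2pi_eq1 (h i0).
  rewrite mxE => /(canRL (mulfVK M0)).
  rewrite -[X in _ * X]/((d.+1 * n)%N%:~R) -rmorphM => /intr_inj ->.
  by rewrite eqz_mod_dvd subr0 dvdz_mull.
Qed.

Lemma HH_sub k l : HH d k -> HH d l -> HH d (k - l).
Proof.
move=> [k0 km] [l0 lm]; split=> [|i j].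
  rewrite (eq_bigr (fun i => k 0 i - l 0 i)) => [|i _]; last by rewrite !mxE.
  by rewrite sumrB k0 l0 subrr.
rewrite !mxE; apply/eqP; rewrite eqz_mod_dvd.
have /eqP := km i j; have /eqP := lm i j; rewrite !eqz_mod_dvd => hl hk.
rewrite (_ : _ - _ = (k 0 i - k 0 j) - (l 0 i - l 0 j)); last by ring.
exact: rpredB.
Qed.

Lemma card_congruent_pairs k l : Lambda d n k -> Lambda d n l ->
  (\sum_(s : 'S_d.+1) \sum_(u : 'S_d.+1)
    [forall i, (k 0%R (s i) == l 0%R (u i) %[mod M])%Z] =
  if k == l then d.+1`! * stabmod n k else 0)%N.
Proof.
move=> kL lL; rewrite exchange_big /=; case: eqP => [<-|kl].
  rewrite (eq_bigr (fun=> stabmod n k)) => [|u _].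
    by rewrite sum_nat_const card_Sn.
  rewrite (reindex_inj (mulgI u)) /stabmod -sum1_card [RHS]big_mkcond.
  apply: eq_bigr => s _; rewrite inE; congr nat_of_bool.
  apply/forallP/forallP => h i; last by rewrite permM.
  by have := h (u^-1%g i); rewrite permM permKV.
rewrite big1// => u _; rewrite big1// => s _.
case: forallP => // h; case: kl.
apply: (@Lambda_unique _ _ _ _ (u^-1 * s)%g n0 kL lL) => i.
by have /eqP := h (u^-1%g i); rewrite permKV permM => ->.
Qed.

Lemma lambda_neq0 k : Lambda d n k -> lambda R n k != 0.
Proof.
move=> /(lambda_stabmod R n0); case: eqP => // -> /eqP.
by rewrite mul0r eq_sym (negPf (natr_gt0_neq0 _ (fact_gt0 _))).
Qed.

(** Folding the sum back to the full index set and expanding [TC_k] and [TC_l] over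
    permutations reduces to the orthogonality of exponentials; what remains is the
    number of pairs of permutations making [k] and [l] congruent. *)
Lemma TC_gram k l : Lambda d n k -> Lambda d n l ->
  \sum_(j <- LS) lambda R n j * (TC k (node R n j) * (TC l (node R n j))^*%R) =
  if k == l then (d.+1 * n ^ d)%N%:R / lambda R n k else 0.
Proof.
move=> kL lL; pose T j := TC k (node R n j) * (TC l (node R n j))^*%R.
have f0 : d.+1`!%:R != 0 :> R[i] by rewrite natr_gt0_neq0 ?fact_gt0.
have -> : \sum_(j <- LS) lambda R n j * T j = \sum_(j <- HS) cweight R n j * T j.
  rewrite sum_Hstar; apply: eq_bigr => j _.
  rewrite (eq_bigr (fun=> T j)) => [|s _]; last by rewrite /T node_col_perm !TC_col_perm.
  by rewrite sumr_const card_Sn -[X in _ / _ * X]mulr_natl [RHS]mulrA mulfVK.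
have TE j : T j = d.+1`!%:R^-1 ^+ 2 * \sum_(s : 'S_d.+1) \sum_(u : 'S_d.+1)
    phi (col_perm s k - col_perm u l) (node R n j).
  rewrite /T !TC_sum_index rmorphM rmorph_sum fmorphV rmorph_nat /= mulrACA -expr2.
  rewrite mulr_suml; congr (_ * _); apply: eq_bigr => s _; rewrite mulr_sumr.
  by apply: eq_bigr => u _; rewrite phiD phiN.
under eq_bigr => j _ do rewrite TE mulrCA.
rewrite -mulr_sumr.
have -> : \sum_(j <- HS) cweight R n j * \sum_(s : 'S_d.+1) \sum_(u : 'S_d.+1)
    phi (col_perm s k - col_perm u l) (node R n j) =
  \sum_(s : 'S_d.+1) \sum_(u : 'S_d.+1)
    ([forall i, (k 0%R (s i) == l 0%R (u i) %[mod M])%Z])%:R * (d.+1 * n ^ d)%N%:R.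
  under eq_bigr => j _ do rewrite mulr_sumr.
  rewrite exchange_big; apply: eq_bigr => s _ /=.
  under eq_bigr => j _ do rewrite mulr_sumr.
  rewrite exchange_big; apply: eq_bigr => u _ /=.
  rewrite phi_discrete_orthogonality; last first.
    by apply: HH_sub; apply: HH_col_perm; [case: kL|case: lL].
  rewrite (_ : [forall i, _] = [forall i, (k 0%R (s i) == l 0%R (u i) %[mod M])%Z]).
    by case: ifP => _; rewrite ?mul1r ?mul0r.
  by apply: eq_forallb => i; rewrite !mxE !eqz_mod_dvd subr0.
under eq_bigr => s _ do rewrite -mulr_suml -natr_sum.
rewrite -mulr_suml -natr_sum card_congruent_pairs//; case: eqP => _; last by rewrite mul0r mulr0.
have l0 := lambda_neq0 kL.
rewrite natrM -{2}(lambda_stabmod R n0 kL) -(lambda_stabmod R n0 kL).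
have s0 : (stabmod n k)%:R != 0 :> R[i].
  by apply: contraNneq f0 => s0; rewrite -(lambda_stabmod R n0 kL) s0 mulr0.
by field; rewrite s0 l0.
Qed.

End WeightedSums.

(** * The compact formula *)

Section SineQuotient.
Variable R : realType.
Implicit Types x y : R.

(** The Dirichlet-type form of [sin (n x) / sin x], defined also at the zeros of the
    sine. *)
Definition cos_sum n x : R := \sum_(m < n) cos ((m.*2.+1%:R - n%:R) * x).

Lemma sin_cos_sum n x : sin x * cos_sum n x = sin (n%:R * x).
Proof.
pose f (m : nat) := sin ((m.*2%:R - n%:R) * x).
have step (m : nat) : f m.+1 - f m = 2 * (sin x * cos ((m.*2.+1%:R - n%:R) * x)).
  rewrite /f doubleS; set a := (m.*2.+1%:R - n%:R) * x.
  have -> : (m.*2.+2%:R - n%:R) * x = a + x by rewrite /a -[m.*2.+2%:R]natr1; ring.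
  have -> : (m.*2%:R - n%:R) * x = a - x by rewrite /a -natr1; ring.
  by rewrite sinD sinB; ring.
apply: (@mulfI _ (2 : R)); first by rewrite pnatr_eq0.
rewrite /cos_sum !mulr_sumr.
under eq_bigr => m _ do rewrite -step.
rewrite -(big_mkord xpredT (fun m => f m.+1 - f m)) telescope_sumr//.
have -> : f 0%N = - sin (n%:R * x) by rewrite /f double0 sub0r mulNr sinN.
have -> : f n = sin (n%:R * x) by rewrite /f -addnn natrD addrK.
by ring.
Qed.

Lemma cos_sumE n x :
  (cos_sum n x)%:C = expi ((1 - n%:R) * x) * geom n (expi (2 * x)).
Proof.
have -> : expi ((1 - n%:R) * x) * geom n (expi (2 * x)) =
    \sum_(m < n) expi ((m.*2.+1%:R - n%:R) * x).
  rewrite /geom mulr_sumr; apply: eq_bigr => m _.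
  rewrite -expiMn -expiD; congr expi.
  by rewrite -[m.*2.+1%:R]natr1 -[m.*2]muln2 natrM; ring.
(* The imaginary parts cancel in pairs under the reversal of the summation order. *)
pose g (m : 'I_n) := (m.*2.+1%:R - n%:R) * x.
have s0 : \sum_(m < n) sin (g m) = 0.
  have E : \sum_(m < n) sin (g m) = - \sum_(m < n) sin (g m).
    rewrite [LHS](reindex_inj rev_ord_inj) -sumrN; apply: eq_bigr => m _.
    rewrite -sinN /g /=; congr sin; rewrite -mulNr; congr (_ * _).
    have -> : n%:R = (n - m.+1)%N%:R + m%:R + 1 :> R.
      by rewrite -addrA natr1 -natrD subnK.
    by rewrite -![_.*2.+1%:R]natr1 -![_.*2]muln2 !natrM; ring.
  lra.
rewrite (eq_bigr (fun m : 'I_n => (cos (g m))%:C + 'i%C * (sin (g m))%:C)) => [|m _].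
  by rewrite big_split /= -mulr_sumr -!rmorph_sum /= s0 mulr0 addr0.
exact: complexE (expi (g m)).
Qed.

Lemma continuous_cos_sum n : continuous (fun x : R => cos_sum n (pi * x)).
Proof.
move=> x; apply: cvg_big => [|m _]; first exact: add_continuous.
apply: (@continuous_comp _ _ _ (fun y : R => (m.*2.+1%:R - n%:R) * (pi * y)) (@cos R));
  last exact: continuous_cos.
by apply: cvgM; [exact: cvg_cst | apply: cvgM; [exact: cvg_cst | exact: cvg_id]].
Qed.

Lemma sin_pi_neq0_near x : sin (pi * x) = 0 -> \forall y \near x^', sin (pi * y) != 0.
Proof.
move=> sx; apply: filterS (dnbhs_ball x (@ltr01 R)) => y [yb /eqP yx].
have cx : cos (pi * x) != 0.
  by apply/eqP => cx; have := cos2Dsin2 (pi * x); rewrite sx cx; lra.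
have pos (h : R) : 0 < h -> h < 1 -> 0 < sin (pi * h).
  by move=> h0 h1; apply: sin_gt0_pi; rewrite mulr_gt0 ?pi_gt0//= gtr_pMr ?pi_gt0.
have -> : pi * y = pi * (y - x) + pi * x by ring.
rewrite sinD sx mulr0 addr0 mulf_neq0//.
move: yb; rewrite /ball /= ltr_norml => /andP[yb1 yb2].
have [xy|xy|xy] := ltgtP (y - x) 0.
- by rewrite -oppr_eq0 -sinN -mulrN gt_eqF// pos//; lra.
- by rewrite gt_eqF// pos//; lra.
- by case/eqP: yx; lra.
Qed.

(** Off the zeros of the sine the quotient is [cos_sum], which is continuous; so
    [cos_sum] also gives the limit at the zeros, which are isolated. *)
Lemma sin_quotientE n x : sin_quotient n x = cos_sum n (pi * x).
Proof.
have E y : sin (pi * y) != 0 -> sin (pi * n%:R * y) / sin (pi * y) = cos_sum n (pi * y).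
  by move=> sy; rewrite [pi * _]mulrC -mulrA -sin_cos_sum mulrAC mulfV// mul1r.
rewrite /sin_quotient; case: ifPn => [/eqP sx|/E//].
apply: cvg_lim => //.
have /continuous_withinNx c : {for x, continuous (fun y : R => cos_sum n (pi * y))}.
  exact: continuous_cos_sum.
apply: cvg_trans c; apply: near_eq_cvg.
by apply: filterS (sin_pi_neq0_near sx) => y /E.
Qed.

End SineQuotient.

Section CompactFormula.
Variables (R : realType) (d n : nat).
Implicit Types (t : 'rV[R]_d.+1).

Lemma real_cosE (x : R) : (cos x)%:C = (expi x + expi (- x)) / 2.
Proof. by rewrite expiN (ReJ_add (expi x)). Qed.

Lemma RH_sum_but t j (J : {set 'I_d.+1}) : RH R d t -> j \notin J ->
  \sum_(i in J) t 0 i + \sum_(i in (~: J) :\ j) t 0 i = - t 0 j.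
Proof.
move=> t0 jJ; have {}t0 : \sum_i t 0 i = 0 by [].
apply/eqP; rewrite -addr_eq0 -[X in _ == X]t0; apply/eqP.
rewrite [RHS](bigID (mem J)) -addrA /=; congr (_ + _).
rewrite [RHS](bigD1 j)//= addrC; congr (_ + _).
by apply: eq_bigl => i; rewrite !inE andbC.
Qed.

(** Each cosine is the mean of two conjugate exponentials.  Since the [t_i] sum to 0,
    the second one for [J] is the first one for the complement of [J] and [j], and
    the coefficients are the same for these two sets. *)
Lemma cos_subset_sum t j : RH R d t ->
  (\sum_(J : {set 'I_d.+1} | j \notin J)
     ((#|J|)`! * (d - #|J|)`!)%N%:R / d.+1`!%:R *
     cos (pi * (t 0 j + 2 * \sum_(i in J) t 0 i)))%:C =
  expi (pi * t 0 j) *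
    integral01 (\prod_(i | i != j) mixture (expi (2 * pi * t 0 i))).
Proof.
move=> t0; rewrite integral01_prod_mixture card_ord.
pose w (J : {set 'I_d.+1}) : R[i] := ((#|J|)`! * (d - #|J|)`!)%N%:R / d.+1`!%:R.
pose z (J : {set 'I_d.+1}) := \prod_(i in J) expi (2 * pi * t 0 i).
pose h (J : {set 'I_d.+1}) := ((~: J) :\ j)%SET.
have hK (J : {set 'I_d.+1}) : j \notin J -> h (h J) = J.
  move=> jJ; apply/setP => i; rewrite !inE.
  by case: eqVneq => [->|_]; rewrite ?negbK// (negPf jJ).
have hj (J : {set 'I_d.+1}) : j \notin h J by rewrite !inE eqxx.
have ch (J : {set 'I_d.+1}) : j \notin J -> #|h J| = (d - #|J|)%N.
  move=> jJ; have := cardsC J; rewrite card_ord (cardsD1 j (~: J)) inE jJ /= -/(h J).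
  by set a := #|h J|; set b := #|J|; lia.
have wh (J : {set 'I_d.+1}) : j \notin J -> w (h J) = w J.
  move=> jJ; rewrite /w ch// subKn 1?mulnC//.
  by have := max_card (mem (j |: J)%SET); rewrite card_ord cardsU1 jJ /= add1n.
have sym : \sum_(J : {set 'I_d.+1} | j \notin J) w J * z (h J) =
    \sum_(J : {set 'I_d.+1} | j \notin J) w J * z J.
  rewrite [RHS](reindex_onto h h) /=; last by move=> J; exact: hK.
  apply: eq_big => [J|J jJ]; last by rewrite wh.
  rewrite hj /=; apply/idP/eqP => [/hK//|<-]; exact: hj.
rewrite rmorph_sum.
transitivity (\sum_(J : {set 'I_d.+1} | j \notin J)
    (w J * z J + w J * z (h J)) * (expi (pi * t 0 j) / 2)).
  apply: eq_bigr => J jJ; rewrite rmorphM /= real_cosE.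
  have -> : (((#|J|)`! * (d - #|J|)`!)%N%:R / d.+1`!%:R : R)%:C = w J.
    by rewrite rmorphM fmorphV !rmorph_nat.
  have -> : - (pi * (t 0 j + 2 * \sum_(i in J) t 0 i)) =
      pi * t 0 j + 2 * pi * \sum_(i in h J) t 0 i.
    by rewrite [\sum_(i in h J) _](canRL (addKr _) (RH_sum_but t0 jJ)); ring.
  rewrite mulrDr mulrA [pi * 2]mulrC !mulr_sumr !expiD !expi_sum -/(z J) -/(z (h J)).
  by ring.
rewrite -mulr_suml big_split /= sym /w /z; set S := \sum_(_ | _) _.
by field.
Qed.

(** The sine quotient is [exp ((1 - n) pi i t)] times a geometric sum in
    [exp (2 pi i t)].  The product of these phases over [i <> j] combines with
    [cos (pi n t_j)] and the phase of [cos_subset_sum] into the factor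
    [(1 + x_j^n) / 2] of [interp_kernel_symmetrized]. *)
Lemma Phistar_compactE t : RH R d t ->
  (Phistar_compact n t)%:C =
  (d.+1 * n ^ d)%N%:R^-1 * interp_kernel n (fun i => expi (2 * pi * t 0 i)).
Proof.
move=> t0; have x1 : \prod_i expi (2 * pi * t 0 i) = 1.
  by rewrite -expi_sum -mulr_sumr t0 mulr0 expi0.
rewrite -(interp_kernel_symmetrized n x1) /Phistar_compact rmorphM fmorphV rmorph_nat.
congr (_ * _); rewrite rmorph_sum; apply: eq_bigr => j _.
rewrite !rmorphM /= cos_subset_sum// rmorph_prod /= real_cosE.
under eq_bigr => i _ do rewrite sin_quotientE cos_sumE !mulrA.
rewrite big_split /= -expi_sum -mulr_sumr.
have -> : \sum_(i | i != j) t 0 i = - t 0 j.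
  by apply/eqP; rewrite -addr_eq0 addrC -[X in _ == X]t0 [X in _ == X](bigD1 j).
set P := \prod_(_ | _) _; set L := integral01 _.
have e1 : expi ((1 - n%:R) * pi * - t 0 j) * expi (pi * t 0 j) *
    (expi (pi * n%:R * t 0 j) + expi (- (pi * n%:R * t 0 j))) =
    1 + expi (2 * pi * t 0 j) ^+ n.
  rewrite mulrDr -expiMn -!expiD addrC -expi0; congr (expi _ + expi _); ring.
by rewrite -e1; ring.
Qed.

End CompactFormula.

(** * Interpolation *)

Section Interpolation.
Variables (R : realType) (d n : nat).
Hypothesis n0 : (0 < n)%N.
Implicit Types (t : 'rV[R]_d.+1) (k l j : 'rV[int]_d.+1) (f g : 'rV[R]_d.+1 -> R[i]).
Local Notation HS := (fset_set (Hstar d n)).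
Local Notation LS := (fset_set (Lambda d n)).
Local Notation normalisation := ((d.+1 * n ^ d)%N%:R : R[i]).

Lemma normalisation_neq0 : normalisation != 0.
Proof. by rewrite natr_gt0_neq0// muln_gt0 expn_gt0 n0. Qed.

Lemma ell_triangleE j t : ell_triangle n j t =
  lambda R n j / normalisation *
  \sum_(k <- LS) lambda R n k * (TC k t * (TC k (node R n j))^*%R).
Proof.
rewrite /ell_triangle fsbig_finite; last exact: finite_Lambda.
by congr (_ * _); apply: eq_bigr => k _; rewrite mulrA.
Qed.

Lemma PhistarE t : Phistar n t = normalisation^-1 * \sum_(k <- HS) cweight R n k * phi k t.
Proof. by rewrite /Phistar fsbig_finite//; exact: finite_Hstar. Qed.

Lemma LstarE f t :
  Lstar n f t = \sum_(j <- LS) f (node R n j) * ell_triangle n j t.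
Proof. by rewrite /Lstar fsbig_finite//; exact: finite_Lambda. Qed.

Lemma inTC_Lstar f : inTC n (Lstar n f).
Proof.
exists (fun k => \sum_(j <- LS) f (node R n j) * (lambda R n j / normalisation) *
   lambda R n k * (TC k (node R n j))^*%R) => t _.
rewrite LstarE fsbig_finite; last exact: finite_Lambda.
under [RHS]eq_bigr => k _ do rewrite mulr_suml.
rewrite [RHS]exchange_big /=; apply: eq_bigr => j _.
by rewrite ell_triangleE mulr_sumr mulr_sumr; apply: eq_bigr => k _; ring.
Qed.

(** At the node of [j'] the sum over [k] is, by the symmetry of node and index, the
    orthogonality relation of [TC_j] and [TC_j']. *)
Lemma ell_triangle_node j j' : Lambda d n j -> Lambda d n j' ->
  ell_triangle n j (node R n j') = (j == j')%:R.
Proof.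
move=> jL j'L; rewrite ell_triangleE.
under eq_bigr => k _ do rewrite TC_nodeC [TC k (node R n j)]TC_nodeC.
rewrite TC_gram// eq_sym; case: eqVneq => [->|_]; last by rewrite mulr0.
have l0 := lambda_neq0 R n0 j'L; have v0 := normalisation_neq0.
by rewrite mulrA mulfVK// mulfV.
Qed.

(** Interpolation reproduces the space: the sum over the nodes comes first and
    applies the orthogonality relation of [TC_k] and [TC_l]. *)
Lemma sum_TC_ell_triangle k t : Lambda d n k ->
  \sum_(j <- LS) TC k (node R n j) * ell_triangle n j t = TC k t.
Proof.
move=> kL.
transitivity (\sum_(l <- LS) lambda R n l * TC l t / normalisation *
    \sum_(j <- LS) lambda R n j * (TC k (node R n j) * (TC l (node R n j))^*%R)).
  under eq_bigr => j _ do rewrite ell_triangleE !mulr_sumr.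
  rewrite exchange_big /=; apply: eq_bigr => l _; rewrite mulr_sumr.
  by apply: eq_bigr => j _; ring.
have kS : k \in LS by apply/mem_Lambda_fset.
have l0 := lambda_neq0 R n0 kL; have v0 := normalisation_neq0.
rewrite (bigD1_seq _ kS (fset_uniq _))/= TC_gram// eqxx [X in _ + X]big1_seq.
  by rewrite addr0 mulrA mulfVK// mulrAC mulfV// mul1r.
move=> l /andP[lk lS]; have lL : Lambda d n l by apply/mem_Lambda_fset.
by rewrite TC_gram// eq_sym (negPf lk) mulr0.
Qed.

Lemma interpolates_Lstar f : interpolates n (Lstar n f) f.
Proof.
move=> j jL; have jS : j \in LS by apply/mem_Lambda_fset.
rewrite LstarE (bigD1_seq _ jS (fset_uniq _))/= ell_triangle_node// eqxx mulr1.
rewrite big1_seq ?addr0// => l /andP[lj lS].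
have lL : Lambda d n l by apply/mem_Lambda_fset.
by rewrite ell_triangle_node// (negPf lj) mulr0.
Qed.

(** An element of the space is its own interpolant by [sum_TC_ell_triangle], and the
    interpolant depends on the values at the nodes only. *)
Lemma interpolant_unique f g : inTC n g -> interpolates n g f ->
  forall t, RH R d t -> g t = Lstar n f t.
Proof.
move=> [a ga] gf t t0.
transitivity (\sum_(j <- LS) g (node R n j) * ell_triangle n j t); last first.
  rewrite LstarE big_seq [RHS]big_seq; apply: eq_bigr => j jS.
  by rewrite gf//; apply/mem_Lambda_fset.
have gE u : RH R d u -> g u = \sum_(k <- LS) a k * TC k u.
  by move=> /ga ->; rewrite fsbig_finite//; exact: finite_Lambda.
transitivity (\sum_(j <- LS) \sum_(k <- LS)
    a k * (TC k (node R n j) * ell_triangle n j t)); last first.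
  rewrite big_seq [RHS]big_seq; apply: eq_bigr => j jS.
  have [jH _ _] : Lambda d n j by apply/mem_Lambda_fset.
  rewrite gE; last exact: node_RH.
  by rewrite mulr_suml; apply: eq_bigr => k _; rewrite mulrA.
rewrite exchange_big gE//= big_seq [RHS]big_seq; apply: eq_bigr => k kS.
by rewrite -mulr_sumr sum_TC_ell_triangle//; apply/mem_Lambda_fset.
Qed.

Lemma TC_index_col_perm s k t : TC (col_perm s k) t = TC k t.
Proof.
rewrite !TC_sum_index; congr (_ * _); rewrite [RHS](reindex_inj (@mulIg _ s)).
by apply: eq_bigr => u _; rewrite col_permM.
Qed.

(** Averaging [Phi*_n (t - node)] over the permutations of [t] replaces [phi_k (t)] by
    [TC_k (t)]; folding the sum over [k] then averages the other factor as well. *)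
Lemma ell_triangle_Pplus j t :
  ell_triangle n j t = lambda R n j * Pplus (ell n j) t.
Proof.
have f0 : d.+1`!%:R != 0 :> R[i] by rewrite natr_gt0_neq0 ?fact_gt0.
pose G k := TC k t * (phi k (node R n j))^*%R.
have -> : Pplus (ell n j) t = normalisation^-1 * \sum_(k <- HS) cweight R n k * G k.
  rewrite /Pplus /ell; under eq_bigr => s _ do rewrite PhistarE.
  rewrite -mulr_sumr mulrCA; congr (_ * _); rewrite exchange_big mulr_sumr /=.
  apply: eq_bigr => k _; rewrite -mulr_sumr mulrCA; congr (_ * _).
  under eq_bigr => s _ do rewrite phiB_arg.
  by rewrite -mulr_suml mulrA.
rewrite ell_triangleE sum_Hstar// mulrA; congr (_ * _).
apply: eq_bigr => k _; rewrite -[RHS]mulrA; congr (_ * _).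
rewrite /G; under [in RHS]eq_bigr => s _ do rewrite TC_index_col_perm.
rewrite -mulr_sumr mulrCA; congr (_ * _).
by rewrite TC_sum_index rmorphM rmorph_sum fmorphV rmorph_nat.
Qed.

End Interpolation.

Theorem theorem4p7 (R : realType) (d n : nat) (hd : (1 <= d)%N) (hn : (0 < n)%N) :
  [/\ (forall f : 'rV[R]_d.+1 -> R[i]^o,
         {within triangleH R d, continuous f} ->
         [/\ inTC n (Lstar n f),
             interpolates n (Lstar n f) f &
             forall g : 'rV[R]_d.+1 -> R[i],
               inTC n g -> interpolates n g f ->
               forall t, RH R d t -> g t = Lstar n f t]),
      (forall j : 'rV[int]_d.+1, Lambda d n j ->
         forall t, RH R d t ->
           ell_triangle n j t = lambda R n j * Pplus (ell n j) t) &
      (forall t, RH R d t -> Phistar n t = (Phistar_compact n t)%:C)].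
Proof.
split=> [f _|j _ t _|t t0].
- split; [exact: inTC_Lstar | exact: interpolates_Lstar |].
  by move=> g; exact: interpolant_unique.
- exact: ell_triangle_Pplus.
- by rewrite PhistarE sum_Hstar_phi// Phistar_compactE.
Qed.
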